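(* Work in the setting of the context (classical $M$-estimation). Assume: (i) $G(\theta,\cdot)$ is $\mathbb P^Z$-integrable for every $\theta\in\Theta$, and $G(\theta_k,\cdot)\to G(\theta,\cdot)$ in $\mathbb P^Z$-probability whenever $\theta_k\to\theta$ in $\Theta$. (ii) There is a strictly positive square $\mathbb P^Z$-integrable $\xi^G:\mathbb R^d\to\mathbb R$ with $\sup_{\theta\in\Theta}|G(\theta,z)|\le\xi^G(z)$ for all $z\in\mathbb R^d$. (iii) The function $\theta\mapsto\mathbb E[G(\theta,Z_1)]$ has a unique minimizer $\theta^*$ over $\Theta$, and there is $M_1>0$ with $\mathbb E[G(\theta,Z_1)]-\mathbb E[G(\theta^*,Z_1)]\ge M_1\|\theta-\theta^*\|_m^2$ for all $\theta\in\Theta$. (iv) For every $\delta>0$ there exist an at most countable $\mathcal C(\mathcal U_\delta)\subseteq\mathcal U_\delta$ and $(\mathbb P^Z)^n$-null sets $N_n^\delta$ ($n\in\mathbb N$) such that $\inf_{\vartheta\in\mathcal C(\mathcal U_\delta)}\{\mathbb E[|G(\theta,Z_1)-G(\vartheta,Z_1)|]+\max_{1\le j\le n}|G(\theta,z_j)-G(\vartheta,z_j)|\}=0$ for all $\theta\in\mathcal U_\delta$, $n\in\mathbb N$, $(z_1,\dots,z_n)\in\mathbb R^{dn}\setminus N_n^\delta$. (v) There exist $\beta\in\,]0,1]$, $\overline M_1,\overline M^1>0$ and square $\mathbb P^Z$-integrable positive envelopes $\xi^G_\delta$ of $\mathbb F^\Theta_\delta$ ($\delta\in\,]0,\Delta(\Theta)]$)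 such that $\|\xi^G_\delta\|_{\mathbb P^Z,2}\le\overline M_1\delta^\beta$ and $J(\mathbb F^\Theta_\delta,\xi^G_\delta,1/8)\vee J(\mathbb F^\Theta,\xi^G,1/8)\le\overline M^1$ for all $\delta\in\,]0,\Delta(\Theta)]$. Let $a,b,\varepsilon>0$ with $a\,2^{\beta+1/2}\le b\,\varepsilon^{\beta+1/2}$, put $\delta_{nk}:=2^kn^{-1/(4-2\beta)}$ ($k\in\mathbb Z$, $n\in\mathbb N$), and $$P_{n2}^\varepsilon:=\sum_{\substack{k\ge K_\varepsilon+1\\ \delta_{n(k-1)}\le\Delta(\Theta)}}\mathbb P\big(\Omega\setminus\Omega^n_{\delta_{nk}\wedge\Delta(\Theta),\,\sqrt2^{\,k}b}\big),\qquad P_{n3}^\varepsilon:=\sum_{\substack{k\ge K_\varepsilon+1\\ \delta_{n(k-1)}\le\Delta(\Theta)}}\mathbb P\big(\Omega\setminus B_n^{\xi^G_{\delta_{nk}\wedge\Delta(\Theta)}}\big).$$ Let $n\in\mathbb N$ with $n\ge\frac{\overline M_1^2\Delta(\Theta)^{2\beta}}2\vee[\overline M_1^2\Delta(\Theta)^{2\beta+1}]^{\frac{4-2\beta}{3-2\beta}}$. Then: 1) $$\mathbb P\big(\{n^{1/(4-2\beta)}\|\widehat\theta_n-\theta^*\|_m>\varepsilon\}\big)\le\frac{10\,\overline M_1\,\widehat\eta}{M_1}\Big(\frac2\varepsilon\Big)^{3/2-\beta}\sqrt{\frac2{\varepsilon\wedge2}}+P_{n2}^\varepsilon+\mathbb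 P(\Omega\setminus\Omega_{n,a}).$$ 2) If $t>0$ satisfies $2^{K_\varepsilon(2-\beta)-K_\varepsilon^+/2}>4\overline M_1[1+2(t+1)\widehat\eta]/M_1$, then $$\mathbb P\big(\{n^{1/(4-2\beta)}\|\widehat\theta_n-\theta^*\|_m>\varepsilon\}\big)\le P_1^{t,\varepsilon}+P_{n2}^\varepsilon+P_{n3}^\varepsilon+\mathbb P(\Omega\setminus\Omega_{n,a}),$$ where $$P_1^{t,\varepsilon}:=\frac{2^{4-\beta}\,\overline M_1}{(3/2-\beta)\ln(2)\,M_1\,\varepsilon^{3/2-\beta}\sqrt{\varepsilon\wedge2}}\exp\Big(-\frac{\varepsilon^{3/2-\beta}\sqrt{\varepsilon\wedge2}\,M_1\,\mathfrak g(t)}{2^{4-\beta}\,\overline M_1}\Big).$$ In particular, the sequence $\big(n^{1/(4-2\beta)}[\widehat\theta_n-\theta^*]\big)_{n\in\mathbb N}$ is uniformly tight.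
   Context: Setting. $(\Omega,\mathcal F,\mathbb P)$ is a complete atomless probability space and $(Z_j)_{j\in\mathbb N}$ are i.i.d. $d$-dimensional random vectors on it with common distribution $\mathbb P^Z$. $\Theta\subset\mathbb R^m$ is compact with Euclidean diameter $\Delta(\Theta)>0$; $\|\cdot\|_m$ is the Euclidean norm. $x\wedge y$, $x\vee y$ denote min and max, $x^+=x\vee0$. $\|f\|_{\mathbb Q,2}=(\int f^2\,d\mathbb Q)^{1/2}$. $G:\Theta\times\mathbb R^d\to\mathbb R$. $(\widehat\theta_n)_{n\in\mathbb N}$ is a sequence of $\Theta$-valued random vectors such that $\widehat\theta_n$ minimizes (for each realization) $\theta\mapsto\frac1n\sum_{j=1}^nG(\theta,Z_j)$ over $\Theta$. Notation. $\mathcal U_\delta:=\{\theta\in\Theta:\|\theta-\theta^*\|_m\le\delta\}$; $\mathbb F^\Theta:=\{G(\theta,\cdot):\theta\in\Theta\}$; $\mathbb F^\Theta_\delta:=\{G(\theta,\cdot)-G(\theta^*,\cdot):\theta\in\mathcal U_\delta\}$. For $\varepsilon>0$, $K_\varepsilon$ is the largest integer not exceeding $\ln(\varepsilon)/\ln(2)$. $(\mathbb P_n-\mathbb P)(f):=\frac1n\sum_{j=1}^n(f(Z_j)-\mathbb E[f(Z_j)])$. Entropy. A positive envelope of a class $\mathbb F$ of Borel functions on $\mathbb R^d$ is a strictly positive Borel function $C_{\mathbb F}$ with $\sup_{h\in\mathbb F}|h|\le C_{\mathbb F}$. $N(\eta,\mathbb F,L^2(\mathbb Q))$ is the minimal number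 of closed $L^2(\mathbb Q)$-balls of radius $\eta$ with centers in $\mathbb F$ needed to cover $\mathbb F$ ($\infty$ if no finite cover exists). $\mathcal M_{\rm fin}$ is the set of probability measures on $\mathcal B(\mathbb R^d)$ with finite support. $J(\mathbb F,C_{\mathbb F},\delta):=\int_0^\delta\sup_{\mathbb Q\in\mathcal M_{\rm fin}}\sqrt{\ln\big(2N(\varepsilon\|C_{\mathbb F}\|_{\mathbb Q,2},\mathbb F,L^2(\mathbb Q))\big)}\,d\varepsilon$. Events and constants. $\Omega_{n,a}:=\{\sup_{\theta\in\Theta}|(\mathbb P_n-\mathbb P)(G(\theta,\cdot))|\le a/\sqrt n\}$; $\Omega^n_{\delta,b}:=\{\sup_{\theta\in\mathcal U_\delta}|(\mathbb P_n-\mathbb P)(G(\theta,\cdot)-G(\theta^*,\cdot))|\le b\delta^\beta/\sqrt n\}$ with $\beta$ from (v); $B_n^\xi:=\{\frac1n\sum_{j=1}^n\xi(Z_j)^2\le2\,\mathbb E[\xi(Z_1)^2]\}$; $\mathfrak g(t):=\frac{t^2}{8(t+1)(5t+28)}$; $\widehat\eta:=64\sqrt2\,(\overline M^1+0.7)$. *)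

(* Defs.v *)
From HB Require Import structures.
From mathcomp Require Import all_boot all_order all_algebra.
From mathcomp Require Import all_classical all_reals all_analysis.

Set Implicit Arguments.
Unset Strict Implicit.
Unset Printing Implicit Defensive.

Import Order.TTheory GRing.Theory Num.Theory.
Import numFieldNormedType.Exports.

Local Open Scope classical_set_scope.
Local Open Scope ring_scope.

(* R^k with its Borel sigma-algebra; the carrier is convertible to 'rV[R]_k.   *)
Notation borel_rV R k := (g_sigma_algebraType (@open 'rV[R]_k)).

(* The canonical norm of 'rV[R]_k in the library is the sup norm.              *)
Definition enorm (R : realType) (k : nat) (x : 'rV[R]_k) : R :=
  Num.sqrt (\sum_(i < k) x 0 i ^+ 2).

Definition diameter (R : realType) (k : nat) (A : set 'rV[R]_k) : R :=
  sup [set enorm (x - y) | x in A & y in A].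

Section Probability.
Context (R : realType).

Definition atomless (d : measure_display) (T : measurableType d)
    (P : probability T R) : Prop :=
  forall A, measurable A -> (0 < P A)%E ->
    exists B, [/\ measurable B, B `<=` A, (0 < P B)%E & (P B < P A)%E].

Definition mutually_independent (d d' : measure_display)
    (T : measurableType d) (T' : measurableType d')
    (P : probability T R) (X : nat -> T -> T') : Prop :=
  forall (s : seq nat) (A : nat -> set T'), uniq s ->
    (forall j, measurable (A j)) ->
    (P (\bigcap_(j in [set` s]) X j @^-1` A j)
      = \prod_(j <- s) P (X j @^-1` A j))%E.

Definition common_distribution (d d' : measure_display)
    (T : measurableType d) (T' : measurableType d')
    (P : probability T R) (X : nat -> T -> T') (Q : probability T' R) : Prop :=
  forall j A, measurable A -> P (X j @^-1` A) = Q A.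

Definition uniformly_tight (d : measure_display) (T : measurableType d)
    (P : probability T R) (k : nat) (X : nat -> T -> 'rV[R]_k) : Prop :=
  forall e : R, 0 < e -> exists K : set 'rV[R]_k,
    compact K /\ forall n, (P (~` (X n @^-1` K)) <= e%:E)%E.

Definition square_integrable (d : measure_display) (T : measurableType d)
    (Q : probability T R) (f : T -> R) : Prop :=
  measurable_fun setT f /\ Q.-integrable setT (fun z => (f z ^+ 2)%:E).

Section PowerMeasure.
Context (d : measure_display) (T : measurableType d) (Q : probability T R).

Definition tuple_cons (n : nat) (x : T * n.-tuple T) : n.+1.-tuple T :=
  [the n.+1.-tuple T of x.1 :: x.2].

Fact measurable_tuple_cons (n : nat) :
  measurable_fun [set: T * n.-tuple T] (@tuple_cons n).
Proof. exact: measurable_cons. Qed.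

HB.instance Definition _ (n : nat) :=
  isMeasurableFun.Build _ _ _ _ (@tuple_cons n) (@measurable_tuple_cons n).

Fixpoint power_measure (n : nat) : probability (n.-tuple T) R :=
  if n is n'.+1 then distribution (Q \x power_measure n')%E (@tuple_cons n')
  else dirac [tuple].

End PowerMeasure.

End Probability.

Section Entropy.
Context (R : realType) (d : nat).
Local Notation Rd := (borel_rV R d).
Implicit Types (F : set (Rd -> R)) (C : Rd -> R).

Definition positive_envelope F C : Prop :=
  [/\ measurable_fun setT C, forall z, 0 < C z &
      forall h, F h -> forall z, `|h z| <= C z].

Definition finitely_supported : set (probability Rd R) :=
  [set Q | exists2 A : set Rd, finite_set A & Q A = 1%E].

(* +oo when there is no finite cover: the infimum is then over set0.           *)
Definition covering_number (eta : \bar R) F (Q : probability Rd R) : \bar R :=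
  ereal_inf [set n%:R%:E | n in [set n : nat |
    exists c : 'I_n -> (Rd -> R), (forall i, F (c i)) /\
      forall h, F h -> exists i,
        (Lnorm Q 2%:E (fun z => (h z - c i z)%:E) <= eta)%E]].

Definition entropy_integral F C (delta : R) : \bar R :=
  (\int[lebesgue_measure]_(e in `]0%R, delta[)
    ereal_sup [set (lne (2%:E *
        covering_number (e%:E * Lnorm Q 2%:E (EFin \o C)) F Q)) `^ (2^-1)
      | Q in finitely_supported])%E.

End Entropy.

Section MEstimation.
Context (R : realType) (m d : nat).
Local Notation Rm := 'rV[R]_m.
Local Notation Rd := (borel_rV R d).
Variables (G : Rm -> Rd -> R) (Theta : set Rm) (theta_star : Rm).

Definition localized (delta : R) : set Rm :=
  [set theta | Theta theta /\ enorm (theta - theta_star) <= delta].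

Definition full_class : set (Rd -> R) := G @` Theta.

Definition local_class (delta : R) : set (Rd -> R) :=
  [set (fun z => G theta z - G theta_star z) | theta in localized delta].

Definition continuous_in_probability (Q : probability Rd R) : Prop :=
  forall (theta_ : nat -> Rm) (theta : Rm),
    (forall k, Theta (theta_ k)) -> Theta theta ->
    theta_ k @[k --> \oo] --> theta ->
    forall e : R, 0 < e ->
      Q [set z | e < `|G (theta_ k) z - G theta z|] @[k --> \oo] --> 0%E.

Context (disp : measure_display) (Omega : measurableType disp).
Variables (P : probability Omega R) (Z : nat -> Omega -> Rd).
(* The sample Z_1, Z_2, ... is numbered from 0: [Z j] is Z_(j+1).              *)

Definition risk (theta : Rm) : R := fine 'E_P[fun w => G theta (Z 0%N w)]%E.

Definition empirical_risk (n : nat) (theta : Rm) (w : Omega) : R :=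
  n%:R^-1 * \sum_(j < n) G theta (Z j w).

Definition unique_minimizer (f : Rm -> R) (x : Rm) : Prop :=
  Theta x /\ forall y, Theta y -> y <> x -> f x < f y.

Definition M_estimator (n : nat) (theta_hat : Omega -> Rm) : Prop :=
  forall w, Theta (theta_hat w) /\
    forall theta, Theta theta ->
      empirical_risk n (theta_hat w) w <= empirical_risk n theta w.

(* Infima and suprema below are taken in \bar R, so that the infimum over an
   empty set is +oo.                                                           *)
Definition separability (Q : probability Rd R) : Prop :=
  forall delta : R, 0 < delta ->
  exists (C : set Rm) (N : forall n : nat, set (n.-tuple Rd)),
    [/\ countable C, C `<=` localized delta,
        (forall n, (0 < n)%N -> (power_measure Q n).-negligible (N n)) &
        forall theta (n : nat) (z : n.-tuple Rd),
          localized delta theta -> (0 < n)%N -> ~ N n z ->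
          ereal_inf [set ('E_P[fun w => `|G theta (Z 0%N w) - G vt (Z 0%N w)|%R]
              + (\big[Num.max/0]_(j < n)
                   `|G theta (tnth z j) - G vt (tnth z j)|)%R%:E)%E
            | vt in C] = 0%E].

Definition empirical_process (n : nat) (f : Rd -> R) (w : Omega) : R :=
  n%:R^-1 * \sum_(j < n) (f (Z j w) - fine 'E_P[fun w' => f (Z j w')]%E).

Definition event_global (n : nat) (a : R) : set Omega :=
  [set w | (ereal_sup [set `|empirical_process n (G theta) w|%:E
              | theta in Theta] <= (a / Num.sqrt n%:R)%:E)%E].

Definition event_local (beta : R) (n : nat) (delta b : R) : set Omega :=
  [set w | (ereal_sup [set `|empirical_process n
                (fun z => G theta z - G theta_star z) w|%:E
              | theta in localized delta]
            <= (b * delta `^ beta / Num.sqrt n%:R)%:E)%E].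

Definition event_B (n : nat) (xi : Rd -> R) : set Omega :=
  [set w | n%:R^-1 * \sum_(j < n) xi (Z j w) ^+ 2
           <= 2 * fine 'E_P[fun w' => (xi (Z 0%N w') ^+ 2)%R]%E].

Definition K_ (eps : R) : int := Num.floor (ln eps / ln 2).

Definition delta_ (beta : R) (n : nat) (k : int) : R :=
  2 ^ k * n%:R `^ (- (4 - 2 * beta)^-1).

Definition shells (beta eps : R) (n : nat) : set int :=
  [set k | (K_ eps + 1 <= k)%R /\ delta_ beta n (k - 1) <= diameter Theta].

Definition P2 (beta b eps : R) (n : nat) : \bar R :=
  (\esum_(k in shells beta eps n)
    P (~` event_local beta n (Num.min (delta_ beta n k) (diameter Theta))
            (Num.sqrt 2 ^ k * b)))%E.

Definition P3 (xi_ : R -> Rd -> R) (beta eps : R) (n : nat) : \bar R :=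
  (\esum_(k in shells beta eps n)
    P (~` event_B n (xi_ (Num.min (delta_ beta n k) (diameter Theta)))))%E.

End MEstimation.

Section Constants.
Context (R : realType).

Definition g_rate (t : R) : R := t ^+ 2 / (8 * (t + 1) * (5 * t + 28)).

Definition eta_hat (Mup : R) : R := 64 * Num.sqrt 2 * (Mup + 7 / 10).

Definition P1 (beta M1 Mlow t eps : R) : R :=
  2 `^ (4 - beta) * Mlow
    / ((3 / 2 - beta) * ln 2 * M1 * eps `^ (3 / 2 - beta)
       * Num.sqrt (Num.min eps 2))
  * expR (- (eps `^ (3 / 2 - beta) * Num.sqrt (Num.min eps 2) * M1 * g_rate t
             / (2 `^ (4 - beta) * Mlow))).

End Constants.

(* Main.v *)
(* The event that theta_hat is far from theta_star is split into dyadic shells.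
   On a shell, the quadratic lower bound on the risk and the minimality of
   theta_hat force a deviation of order n * rho ^ 2 of the empirical process
   indexed by the local class. Symmetrization with the ghost sample
   Z_n, ..., Z_(2n-1), which lives on the same Omega, bounds the probability of
   this deviation through Rademacher averages. Given the 2n points, these are
   controlled by Massart's finite class lemma and chaining, which only needs the
   covering numbers at the empirical measure of the 2n points. Markov's
   inequality then gives the first bound, and McDiarmid's inequality on the
   events B_n the second one. The resulting series over the shells are
   geometric, so that P2 and the probability of the global event, which are
   nonnegative, are not needed. *)
From HB Require Import structures.
Require Import Defs.
From mathcomp Require Import all_boot all_order all_algebra.
From mathcomp Require Import all_classical all_reals all_analysis.
From mathcomp Require Import measurable_realfun ring lra.

Import Order.TTheory GRing.Theory Num.Theory.
Import numFieldNormedType.Exports.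

Local Open Scope classical_set_scope.
Local Open Scope ring_scope.

(** The local class may be uncountable, so the measurability of its supremum is an obstacle.
    Separability replaces the class by a sequence, and every estimate is proved for the first [M]
    functions of this sequence with a bound free of [M]: chaining passes through covers of the whole
    class. The limit in [M] is taken once, when the probability of a shell is bounded. No auxiliary
    space carries the signs: they are boolean lists averaged by recursion, and the law of the
    exchanged pair of samples does not depend on the list. A shell enters the estimates only through
    [signal], the ratio of the risk growth to the noise level of the envelope. It at least doubles
    from one shell to the next, which produces the geometric series. The crude constant 1000 in the
    second bound is affordable because [eta_hat] is at least 125/2: at such signals a Gaussian tail
    is far below the exponential tail [P1]. *)

(** * Averages over random signs and bounded differences *)

Section RademacherAverages.
Context {R : realType}.
Implicit Types (x y : R) (n : nat) (s : seq bool).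

Lemma le_of_derive_ge0 (f df : R -> R) x :
  (forall y, is_derive y 1 f (df y)) -> (forall y, 0 <= y -> 0 <= df y) ->
  0 <= x -> f 0 <= f x.
Proof.
move=> fdf df0 x0.
have [|c] := @MVT_segment _ f df 0 x x0 (fun y _ => fdf y).
  apply: continuous_subspaceT => y.
  by apply: differentiable_continuous; apply/derivable1_diffP; case: (fdf y).
rewrite in_itv /= => /andP[c0 _] H.
by rewrite -subr_ge0 H subr0 mulr_ge0 ?df0.
Qed.

(** For nonnegative arguments the quotient of the two sides is nonincreasing because tanh y <= y.
    The inner claim [key] is this inequality with denominators cleared; it follows in the same way
    from 1 - 2y <= exp(-2y). *)
Lemma cosh_le_expR_sqr x : (expR x + expR (- x)) / 2 <= expR (x ^+ 2 / 2).
Proof.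
wlog x0 : x / 0 <= x.
  move=> H; case: (leP 0 x) => [/H//|x0].
  by have := H (- x); rewrite opprK sqrrN addrC; apply; rewrite oppr_ge0 ltW.
have key y : 0 <= y -> (1 - y) * expR (2 * y) <= 1 + y.
  move=> y0; rewrite -subr_ge0.
  pose g y := 1 + y - (1 - y) * expR (2 * y).
  suff : g 0 <= g y by rewrite /g mulr0 expR0 subr0 addr0 mul1r subrr.
  apply: (@le_of_derive_ge0 g (fun y => 1 - (1 - 2 * y) * expR (2 * y))) => //.
    move=> z; apply: is_derive_eq; rewrite /GRing.scale /=; ring.
  move=> z z0; rewrite subr_ge0.
  have := expR_ge1Dx (- (2 * z)); rewrite expRN => H.
  by rewrite -ler_pdivlMr ?expR_gt0// mul1r.
pose f y := - (expR (y - y ^+ 2 / 2) + expR (- y - y ^+ 2 / 2)).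
have : f 0 <= f x.
  apply: (@le_of_derive_ge0 f (fun y => expR (- y - y ^+ 2 / 2) *
      ((1 + y) - (1 - y) * expR (2 * y)))) => //; last first.
    by move=> y y0; rewrite mulr_ge0 ?expR_ge0 ?subr_ge0 ?key.
  move=> y; apply: is_derive_eq; rewrite /GRing.scale /=.
  have -> : expR (y - y ^+ 2 / 2) = expR (- y - y ^+ 2 / 2) * expR (2 * y).
    by rewrite -expRD; congr expR; ring.
  by field.
rewrite /f lerN2 oppr0 expr0n/= mul0r subr0 !expR0 !expRB -mulrDl => H.
by rewrite ler_pdivrMr// mulrC -ler_pdivrMr ?expR_gt0.
Qed.

(** The mean of [f] over [n] independent fair signs. The recursive form lets inductions average out
    one sign at a time; only lists of size [n] are ever evaluated. *)
Fixpoint rademacher n (f : seq bool -> R) : R :=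
  if n is n'.+1 then
    (rademacher n' (fun s => f (true :: s))
     + rademacher n' (fun s => f (false :: s))) / 2
  else f [::].

Lemma le_rademacher n f g : (forall s, size s = n -> f s <= g s) ->
  rademacher n f <= rademacher n g.
Proof.
elim: n f g => [|n IH] f g fg /=; first exact: fg.
by rewrite ler_pM2r ?invr_gt0// lerD// IH// => s sn; apply: fg => /=; rewrite sn.
Qed.

Lemma eq_rademacher n f g : (forall s, size s = n -> f s = g s) ->
  rademacher n f = rademacher n g.
Proof.
by move=> fg; apply/eqP; rewrite eq_le; apply/andP; split;
  apply: le_rademacher => s /fg ->.
Qed.

Lemma rademacher_cst n (c : R) : rademacher n (fun=> c) = c.
Proof. by elim: n => //= n ->; field. Qed.

Lemma rademacherZ n (c : R) f :
  rademacher n (fun s => c * f s) = c * rademacher n f.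
Proof. by elim: n f => //= n IH f; rewrite !IH; field. Qed.

Lemma rademacherD n f g :
  rademacher n (fun s => f s + g s) = rademacher n f + rademacher n g.
Proof. by elim: n f g => //= n IH f g; rewrite !IH; field. Qed.

Lemma rademacher_sum (I : Type) (r : seq I) n (f : I -> seq bool -> R) :
  rademacher n (fun s => \sum_(i <- r) f i s)
  = \sum_(i <- r) rademacher n (f i).
Proof.
elim: r => [|i r IH].
  rewrite big_nil -[RHS](rademacher_cst n).
  by apply: eq_rademacher => s _; rewrite big_nil.
rewrite big_cons -IH -rademacherD.
by apply: eq_rademacher => s _; rewrite big_cons.
Qed.

(** A weighted Hamming distance: [f s - f s' <= flips n c s s'] is the bounded differences
    condition. *)
Definition flips n (c : nat -> R) s s' : R :=
  \sum_(j < n) c j * (nth false s j != nth false s' j)%:R.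

Lemma flips_cons n (c : nat -> R) b b' s s' :
  flips n.+1 c (b :: s) (b' :: s')
  = c 0%N * (b != b')%:R + flips n (fun j => c j.+1) s s'.
Proof. by rewrite /flips big_ord_recl. Qed.

Lemma flips_refl n (c : nat -> R) s : flips n c s s = 0.
Proof. by rewrite /flips big1// => j _; rewrite eqxx mulr0. Qed.

(* The induction behind McDiarmid's inequality: averaging out one sign costs a
   factor exp(l^2 c^2 / 8), by the cosh bound. *)
Lemma rademacher_expR_le n (c : nat -> R) f l :
  (forall s s', size s = n -> size s' = n -> f s - f s' <= flips n c s s') ->
  rademacher n (fun s => expR (l * f s))
  <= expR (l * rademacher n f + l ^+ 2 * (\sum_(j < n) c j ^+ 2) / 8).
Proof.
elim: n c f => [|n IH] c f fc /=.
  by rewrite big_ord0 mulr0 mul0r addr0.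
have H b : rademacher n (fun s => expR (l * f (b :: s)))
    <= expR (l * rademacher n (fun s => f (b :: s))
             + l ^+ 2 * (\sum_(j < n) c j.+1 ^+ 2) / 8).
  apply: (IH (fun j => c j.+1)) => s s' sn sn'.
  have := fc (b :: s) (b :: s'); rewrite flips_cons eqxx mulr0 add0r.
  by apply; rewrite /= ?sn ?sn'.
have D b : rademacher n (fun s => f (b :: s))
    <= rademacher n (fun s => f (~~ b :: s)) + c 0%N.
  rewrite -[X in _ + X](rademacher_cst n) -rademacherD.
  apply: le_rademacher => s sn; rewrite -lerBlDl.
  have := fc (b :: s) (~~ b :: s); rewrite flips_cons flips_refl addr0.
  by case: b => /=; rewrite mulr1; apply; rewrite sn.
have := D true; have := D false; have := H true; have := H false => /=.
set u := rademacher n (fun s => f (true :: s)).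
set v := rademacher n (fun s => f (false :: s)).
rewrite big_ord_recl.
set S := \sum_(j < n) _ => Hv Hu dv du.
apply: le_trans (_ : (expR (l * u + l ^+ 2 * S / 8)
                     + expR (l * v + l ^+ 2 * S / 8)) / 2 <= _).
  by rewrite ler_pM2r ?invr_gt0// lerD.
have -> : l * u + l ^+ 2 * S / 8
    = l * (u - v) / 2 + (l * ((u + v) / 2) + l ^+ 2 * S / 8) by field.
have -> : l * v + l ^+ 2 * S / 8
    = - (l * (u - v) / 2) + (l * ((u + v) / 2) + l ^+ 2 * S / 8) by field.
rewrite !(expRD (_ (l * (u - v) / 2))) (expRD (l * (u - v) / 2)) -mulrDl mulrAC.
apply: le_trans (ler_wpM2r (expR_ge0 _) (cosh_le_expR_sqr _)) _.
rewrite -expRD ler_expR.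
have d2 : (u - v) ^+ 2 <= c 0%N ^+ 2.
  rewrite -subr_ge0 subr_sqr mulr_ge0//; lra.
have : l ^+ 2 * (u - v) ^+ 2 <= l ^+ 2 * c 0%N ^+ 2.
  by rewrite ler_wpM2l ?sqr_ge0.
rewrite exprMn exprMn; lra.
Qed.

End RademacherAverages.

(** * Maxima of signed sums: mean and tail *)

Section SignedSums.
Context {R : realType}.
Implicit Types (n : nat) (s : seq bool) (g : nat -> R).

Definition sign_sum n g s : R :=
  \sum_(j < n) (if nth false s j then 1 else - 1) * g j.

Definition max_sign_sum n {N} (g : 'I_N -> nat -> R) s : R :=
  \big[Num.max/0]_(i < N) `|sign_sum n (g i) s|.

Lemma sign_sumB n g h s :
  sign_sum n (fun j => g j - h j) s = sign_sum n g s - sign_sum n h s.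
Proof. by rewrite -sumrB; apply: eq_bigr => j _; rewrite mulrBr. Qed.

Lemma sign_sum_eq n g h s : (forall j, (j < n)%N -> g j = h j) ->
  sign_sum n g s = sign_sum n h s.
Proof. by move=> gh; apply: eq_bigr => j _; rewrite gh. Qed.

Lemma norm_sign_sum n g s : `|sign_sum n g s| <= \sum_(j < n) `|g j|.
Proof.
apply: le_trans (ler_norm_sum _ _ _) _; apply: ler_sum => j _.
by rewrite normrM; case: ifP => _; rewrite ?normrN normr1 mul1r.
Qed.

Lemma sign_sum_cons n g b s : sign_sum n.+1 g (b :: s)
  = (if b then 1 else - 1) * g 0%N + sign_sum n (fun j => g j.+1) s.
Proof. by rewrite /sign_sum big_ord_recl. Qed.

Lemma rademacher_sign_sum n g : rademacher n (sign_sum n g) = 0.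
Proof.
elim: n g => [|n IH] g /=; first by rewrite /sign_sum big_ord0.
have H b : rademacher n (fun s => sign_sum n.+1 g (b :: s))
    = (if b then 1 else - 1) * g 0%N.
  under eq_rademacher => s _ do rewrite sign_sum_cons.
  by rewrite rademacherD rademacher_cst IH addr0.
by rewrite (H true) (H false) mulN1r mul1r subrr mul0r.
Qed.

Lemma sign_sum_flips n g s s' :
  sign_sum n g s - sign_sum n g s' <= flips n (fun j => 2 * `|g j|) s s'.
Proof.
rewrite -sumrB; apply: ler_sum => j _.
have := ler_norm (g j); have := ler_norm (- g j); rewrite normrN.
by case: (nth _ s j); case: (nth _ s' j) => /=; lra.
Qed.

(** Flipping the j-th sign moves the sum by twice the modulus of [g j], so the factor 1/8 of the
    bounded differences estimate becomes 1/2. *)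
Lemma rademacher_expR_sign_sum n g l :
  rademacher n (fun s => expR (l * sign_sum n g s))
  <= expR (l ^+ 2 * (\sum_(j < n) g j ^+ 2) / 2).
Proof.
apply: le_trans (@rademacher_expR_le R n (fun j => 2 * `|g j|) _ l _) _.
  by move=> s s' _ _; exact: sign_sum_flips.
rewrite rademacher_sign_sum mulr0 add0r ler_expR.
under eq_bigr do rewrite exprMn real_normK ?num_real//.
rewrite -mulr_sumr; lra.
Qed.

Lemma max_sign_sum_ge0 n N (g : 'I_N -> nat -> R) s : 0 <= max_sign_sum n g s.
Proof. by rewrite /max_sign_sum bigmax_ge_id. Qed.

(** Massart's finite class lemma. The exponential of [l] times the maximum is at most a sum of 2N
    exponentials, two per function because of the absolute value, so its mean is at most [expR L].
    The tangent inequality 1 + u <= exp(u) at u = l * max - L takes the place of Jensen's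
    inequality, and [l = K / r] minimizes L / l. For [r = 0] all terms vanish. *)
Lemma rademacher_max_sign_sum_le n N (g : 'I_N -> nat -> R) (r : R) :
  (0 < N)%N -> 0 <= r ->
  (forall i, \sum_(j < n) g i j ^+ 2 <= r ^+ 2) ->
  rademacher n (max_sign_sum n g) <= r * Num.sqrt (2 * ln (2 * N%:R)).
Proof.
move=> N0 r0 gr.
set K := Num.sqrt _.
have lnN : 0 < ln (2 * N%:R : R).
  by rewrite ln_gt0// -natrM ltr1n; case: N N0 {g gr K} => // N' _; rewrite mul2n doubleS.
have K0 : 0 < K by rewrite sqrtr_gt0 mulr_gt0.
have KK : K ^+ 2 = 2 * ln (2 * N%:R) by rewrite sqr_sqrtr// mulr_ge0// ltW.
have [r00|rneq0] := eqVneq r 0.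
  rewrite r00 mul0r -[X in _ <= X](rademacher_cst n).
  apply: le_rademacher => s _; apply: bigmax_le => // i _.
  apply: le_trans (norm_sign_sum _ _ _) _.
  rewrite big1// => j _; apply/eqP; rewrite normr_eq0 -sqrf_eq0 eq_le sqr_ge0.
  rewrite andbT; apply: le_trans (_ : _ <= \sum_(j < n) g i j ^+ 2) _; last first.
    by have := gr i; rewrite r00 expr0n.
  by rewrite (bigD1 j)//= lerDl sumr_ge0// => k _; rewrite sqr_ge0.
have rgt0 : 0 < r by rewrite lt_def rneq0.
pose l := K / r; have l0 : 0 < l by rewrite divr_gt0.
pose L := ln (2 * N%:R) + l ^+ 2 * r ^+ 2 / 2.
have LE : L = l * (r * K).
  have -> : l * (r * K) = K ^+ 2 by rewrite /l; field.
  by rewrite /L /l expr_div_n divfK ?expf_neq0// KK; lra.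
suff H : l * rademacher n (max_sign_sum n g) <= L.
  by rewrite -(ler_pM2l l0) -LE.
have H1 : rademacher n (fun s => l * max_sign_sum n g s - L)
    <= rademacher n (fun s => \sum_(i < N)
         (expR (- L) * (expR (l * sign_sum n (g i) s)
           + expR ((- l) * sign_sum n (g i) s))) - 1).
  apply: le_rademacher => s _.
  apply: le_trans (_ : expR (l * max_sign_sum n g s - L) - 1 <= _).
    by have := expR_ge1Dx (l * max_sign_sum n g s - L); lra.
  rewrite lerD2r -mulr_sumr addrC expRD ler_wpM2l ?expR_ge0//.
  rewrite /max_sign_sum.
  have [//|//|i _ ->] := eq_bigmax (Ordinal N0) xpredT
    (fun i => `|sign_sum n (g i) s|) (x := 0).
  rewrite (bigD1 i)//= -[leLHS]addr0; apply: lerD; last first.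
    by apply: sumr_ge0 => k _; rewrite addr_ge0 ?expR_ge0.
  have [X0|X0] := leP 0 (sign_sum n (g i) s).
    by rewrite ger0_norm// lerDl expR_ge0.
  by rewrite ltr0_norm// mulrN -mulNr lerDr expR_ge0.
move: H1; rewrite [X in X <= _]rademacherD rademacherZ rademacher_cst => H1.
rewrite -subr_le0; apply: le_trans H1 _.
rewrite rademacherD rademacher_cst rademacher_sum subr_le0.
apply: le_trans (_ : \sum_(i < N) (expR (- L) * (2 * expR (l ^+ 2 * r ^+ 2 / 2))) <= _).
  apply: ler_sum => i _; rewrite rademacherZ rademacherD.
  rewrite ler_wpM2l ?expR_ge0// mulr_natl mulr2n.
  have B l' : l' ^+ 2 = l ^+ 2 -> rademacher n (fun s => expR (l' * sign_sum n (g i) s))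
      <= expR (l ^+ 2 * r ^+ 2 / 2).
    move=> ll; apply: le_trans (rademacher_expR_sign_sum _ _ _) _.
    by rewrite ll ler_expR ler_wpM2r ?invr_ge0// ler_wpM2l ?sqr_ge0.
  by rewrite lerD// B// sqrrN.
rewrite sumr_const card_ord -[X in X <= _]mulr_natr /L opprD expRD.
rewrite [expR (- ln _)]expRN lnK ?posrE ?mulr_gt0 ?ltr0n//.
rewrite expRN.
set E := expR (_ / 2); have E0 : 0 < E by exact: expR_gt0.
have N0' : (0 : R) < N%:R by rewrite ltr0n.
by rewrite le_eqVlt; apply/orP; left; apply/eqP; field; rewrite !gt_eqF.
Qed.

(** McDiarmid's inequality by the Chernoff method. The maximum inherits the bounded differences
    [2 * b j] of each signed sum, so the exponent is -l (u - e) + l^2 B / 2, minimal at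
    [l = (u - e) / B]. *)
Lemma rademacher_max_sign_sum_tail n N (g : 'I_N -> nat -> R) (b : nat -> R)
    (B e u : R) :
  (forall j, 0 <= b j) -> (forall i j, (j < n)%N -> `|g i j| <= b j) ->
  0 < B -> \sum_(j < n) b j ^+ 2 <= B ->
  rademacher n (max_sign_sum n g) <= e -> e <= u ->
  rademacher n (fun s => (u <= max_sign_sum n g s)%R%:R)
  <= expR (- ((u - e) ^+ 2 / (2 * B))).
Proof.
move=> b0 gb B0 bB ge eu.
pose l := (u - e) / B; have l0 : 0 <= l by rewrite divr_ge0 ?subr_ge0// ltW.
apply: le_trans (_ : rademacher n (fun s =>
    expR (- (l * u)) * expR (l * max_sign_sum n g s)) <= _).
  apply: le_rademacher => s _; rewrite -expRD.
  have [h|_] := leP u (max_sign_sum n g s); last exact: expR_ge0.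
  apply: le_trans (expR_ge1Dx _); rewrite lerDl addrC -mulrBr.
  by rewrite mulr_ge0// subr_ge0.
rewrite rademacherZ.
have F : forall s s', size s = n -> size s' = n ->
    max_sign_sum n g s - max_sign_sum n g s' <= flips n (fun j => 2 * b j) s s'.
  move=> s s' sn sn'; rewrite lerBlDr.
  have fl0 : 0 <= flips n (fun j => 2 * b j) s s'.
    by apply: sumr_ge0 => j _; rewrite !mulr_ge0.
  apply: bigmax_le => [|i _]; first by rewrite addr_ge0 ?max_sign_sum_ge0.
  apply: le_trans (_ : _ <= flips n (fun j => 2 * b j) s s'
      + `|sign_sum n (g i) s'|) _; last by rewrite lerD2l le_bigmax.
  have H s1 s2 : sign_sum n (g i) s1 - sign_sum n (g i) s2
      <= flips n (fun j => 2 * b j) s1 s2.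
    apply: le_trans (sign_sum_flips _ _ _ _) _; apply: ler_sum => j _.
    by rewrite ler_wpM2r ?ler0n// ler_pM2l// gb.
  have := H s s'; have := H s' s.
  have -> : flips n (fun j => 2 * b j) s' s = flips n (fun j => 2 * b j) s s'.
    by apply: eq_bigr => j _; rewrite eq_sym.
  rewrite -lerBlDr => H1 H2; apply: le_trans (lerB_dist _ _) _.
  by rewrite ler_norml; apply/andP; split; lra.
apply: le_trans (ler_wpM2l (expR_ge0 _) (rademacher_expR_le n _ _ l F)) _.
rewrite -expRD ler_expR.
under eq_bigr do rewrite exprMn.
rewrite -mulr_sumr.
have H1 : l * rademacher n (max_sign_sum n g) <= l * e by rewrite ler_wpM2l.
have H2 : l ^+ 2 * \sum_(j < n) b j ^+ 2 <= l ^+ 2 * B.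
  by rewrite ler_wpM2l ?sqr_ge0.
have -> : (u - e) ^+ 2 / (2 * B) = l * (u - e) - l ^+ 2 * B / 2.
  by rewrite /l; field; rewrite gt_eqF.
lra.
Qed.

End SignedSums.

(** * Chaining along dyadic covers *)

Section Chaining.
Context {R : realType} {T : Type}.
Variables (n : nat) (y y' : nat -> T).
Implicit Types (h : T -> R).

Definition pair_diff h (j : nat) : R := h (y j) - h (y' j).

(** Up to the factor 1/(2n), the squared L2 norm of [h] under the uniform measure on the 2n
    points. *)
Definition pair_sqr h : R := \sum_(j < n) (h (y j) ^+ 2 + h (y' j) ^+ 2).

Lemma pair_sqr_ge0 h : 0 <= pair_sqr h.
Proof. by apply: sumr_ge0 => j _; rewrite addr_ge0 ?sqr_ge0. Qed.

Lemma pair_sqr_le h h' : (forall z, `|h z| <= h' z) -> pair_sqr h <= pair_sqr h'.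
Proof.
move=> hh'; apply: ler_sum => j _; have sq z : h z ^+ 2 <= h' z ^+ 2.
  by rewrite -[X in X <= _]real_normK ?num_real// lerXn2r ?nnegrE// (le_trans _ (hh' z)).
by rewrite lerD.
Qed.

Lemma sum_pair_diff_sqr_le h :
  \sum_(j < n) pair_diff h j ^+ 2 <= 2 * pair_sqr h.
Proof.
rewrite /pair_sqr mulr_sumr; apply: ler_sum => j _; rewrite /pair_diff.
have := sqr_ge0 (h (y j) + h (y' j)); rewrite sqrrD sqrrB; lra.
Qed.

Lemma sum_norm_pair_diff_le h (r : R) : 0 <= r ->
  2 * pair_sqr h <= r ^+ 2 -> \sum_(j < n) `|pair_diff h j| <= n%:R * r.
Proof.
move=> r0 hr; rewrite -[n in X in _ <= X]card_ord mulr_natl -sumr_const.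
apply: ler_sum => j _; rewrite -[X in _ <= X]ger0_norm// -ler_sqr ?nnegrE//.
rewrite !real_normK ?num_real//; apply: le_trans hr.
apply: le_trans (sum_pair_diff_sqr_le h).
by rewrite (bigD1 j)//= lerDl sumr_ge0// => k _; rewrite sqr_ge0.
Qed.

Lemma max_sign_sum_triangle N N' (g : 'I_N -> T -> R) (h : 'I_N' -> T -> R)
    (p : 'I_N -> 'I_N') s :
  max_sign_sum n (fun i => pair_diff (g i)) s
  <= max_sign_sum n (fun i => pair_diff (h i)) s
     + max_sign_sum n (fun i => pair_diff (fun z => g i z - h (p i) z)) s.
Proof.
apply: bigmax_le => [|i _]; first by rewrite addr_ge0 ?max_sign_sum_ge0.
apply: le_trans (_ : `|sign_sum n (pair_diff (h (p i))) s|
    + `|sign_sum n (pair_diff (fun z => g i z - h (p i) z)) s| <= _).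
  rewrite [X in _ + `|X|](_ : _ = sign_sum n (pair_diff (g i)) s
      - sign_sum n (pair_diff (h (p i))) s); last first.
    by rewrite -sign_sumB; apply: sign_sum_eq => j _; rewrite /pair_diff; ring.
  apply: le_trans (ler_normD _ _); rewrite addrC subrK //.
apply: lerD; first by rewrite (le_bigmax _ (fun i => `|sign_sum n (pair_diff (h i)) s|)).
by rewrite (le_bigmax _
  (fun i => `|sign_sum n (pair_diff (fun z => g i z - h (p i) z)) s|)).
Qed.

Variables (F : set (T -> R)) (xi : T -> R) (N : nat -> nat)
  (c : forall k, 'I_(N k) -> T -> R) (J : R).
Arguments c : clear implicits.

(** The radii are 1/8, 1/16, and so on, starting at the upper limit of the entropy integral. *)
Let eps (k : nat) : R := 2^-1 ^+ (k + 3).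
Let H (k : nat) : R := Num.sqrt (ln (2 * (N k)%:R)).

Hypothesis F_le : forall h, F h -> forall z, `|h z| <= xi z.
Hypothesis N_gt0 : forall k, (0 < N k)%N.
Hypothesis c_F : forall k i, F (c k i).
Hypothesis c_cover : forall k h, F h ->
  exists i, pair_sqr (fun z => h z - c k i z) <= eps k ^+ 2 * pair_sqr xi.
Hypothesis entropy_sum : forall K, \sum_(k < K) H k * (eps k / 2) <= J.

Let r0 := Num.sqrt (2 * pair_sqr xi).

Let r0_sqr : r0 ^+ 2 = 2 * pair_sqr xi.
Proof. by rewrite sqr_sqrtr// mulr_ge0// pair_sqr_ge0. Qed.

Let massart M (g : 'I_M -> T -> R) (e : R) : (0 < M)%N -> 0 <= e ->
  (forall i, pair_sqr (g i) <= e ^+ 2 * pair_sqr xi) ->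
  rademacher n (max_sign_sum n (fun i => pair_diff (g i)))
  <= Num.sqrt 2 * r0 * (e * Num.sqrt (ln (2 * M%:R))).
Proof.
move=> M0 e0 ge.
apply: le_trans (@rademacher_max_sign_sum_le R n M
  (fun i => pair_diff (g i)) (e * r0) M0 _ _) _.
- by rewrite mulr_ge0 ?sqrtr_ge0.
- move=> i; apply: le_trans (sum_pair_diff_sqr_le _) _.
  by rewrite exprMn r0_sqr mulrCA ler_pM2l// ge.
- rewrite sqrtrM// le_eqVlt; apply/orP; left; apply/eqP; ring.
Qed.

Let eps_gt0 k : 0 < eps k. Proof. by rewrite exprn_gt0. Qed.

(** The coarsest centers are bounded by the envelope, that is, at relative radius 1. Since centers
    belong to [F], each center of level K + 1 has a neighbour at level K; only [N K.+1] differences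
    occur, of relative radius [eps K], and Massart's lemma bounds their maximum. *)
Let chain K : rademacher n (max_sign_sum n (fun i => pair_diff (c K i)))
  <= Num.sqrt 2 * r0 * (H 0%N + \sum_(k < K) eps k * H k.+1).
Proof.
elim: K => [|K IH].
  rewrite big_ord0 addr0 -[H _]mul1r; apply: massart => // i.
  by rewrite expr1n mul1r pair_sqr_le// => z; exact: F_le.
have [p cp] := choice (fun i => c_cover K _ (c_F K.+1 i)).
rewrite big_ord_recr/= addrA mulrDr.
apply: le_trans (le_rademacher _ _ _ (fun s _ => max_sign_sum_triangle _ _ (c K.+1) (c K) p s)) _.
rewrite rademacherD lerD//.
by apply: massart => //; rewrite ltW.
Qed.

(** The number [M] of functions does not enter: the chain stops at a level so fine that the
    remaining differences are bounded trivially, without a union bound. *)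
Lemma rademacher_chaining M (f : 'I_M -> T -> R) : (forall i, F (f i)) ->
  rademacher n (max_sign_sum n (fun i => pair_diff (f i)))
  <= 16 * Num.sqrt 2 * (J + 7 / 10) * Num.sqrt (2 * pair_sqr xi).
Proof.
move=> fF; rewrite -/r0.
have s2 : 1 <= Num.sqrt 2 :> R by rewrite -[X in X <= _]sqrtr1 ler_sqrt// ler1n.
have r00 : 0 <= r0 by exact: sqrtr_ge0.
have [K nK] : exists K, n%:R * eps K <= 1.
  have [K hK] : exists K, (n <= 2 ^ K)%N by exists n; rewrite ltnW// ltn_expl.
  exists K; rewrite /eps exprVn ler_pdivrMr ?exprn_gt0// mul1r -natrX ler_nat.
  by rewrite (leq_trans hK)// leq_exp2l// leq_addr.
have [p fp] := choice (fun i => c_cover K _ (fF i)).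
apply: le_trans (le_rademacher _ _ _ (fun s _ => max_sign_sum_triangle _ _ f (c K) p s)) _.
rewrite rademacherD.
have -> : 16 * Num.sqrt 2 * (J + 7 / 10) * r0 = Num.sqrt 2 * r0 * (16 * J)
   + Num.sqrt 2 * r0 * (112 / 10) by field.
apply: lerD.
  apply: le_trans (chain K) _; rewrite ler_wpM2l ?mulr_ge0 ?sqrtr_ge0//.
  (* The coarsest level dictates the factor 16: [H 0] has weight 1 = 16 * (eps 0 / 2), whereas the
     finer levels would need only 4. *)
  apply: le_trans (_ : 16 * \sum_(k < K.+1) H k * (eps k / 2) <= _); last first.
    by rewrite ler_pM2l.
  rewrite big_ord_recl mulrDr; apply: lerD; first by rewrite /eps add0n; lra.
  rewrite mulr_sumr; apply: ler_sum => k _; rewrite /= /bump/= add1n.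
  have -> : eps k.+1 = eps k / 2 by rewrite /eps addSn exprS mulrC.
  have : 0 <= eps k * H k.+1 by rewrite mulr_ge0 ?sqrtr_ge0// ltW.
  lra.
(* By [n * eps K <= 1] the remainder is at most [r0]; the summand 7/10 in the constant absorbs
   it. *)
apply: le_trans (_ : rademacher n (fun=> r0) <= _).
  apply: le_rademacher => s _; apply: bigmax_le => // i _.
  apply: le_trans (norm_sign_sum _ _ _) _.
  apply: le_trans (@sum_norm_pair_diff_le _ (eps K * r0) _ _) _.
  - by rewrite mulr_ge0// ltW.
  - by rewrite exprMn r0_sqr mulrCA ler_pM2l// fp.
  - by rewrite mulrA ler_piMl.
rewrite rademacher_cst mulrAC ler_peMl//.
by apply: le_trans s2 _; rewrite ler_peMr ?sqrtr_ge0//; lra.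
Qed.

End Chaining.

(** * The empirical measure of the two samples *)

Section EmpiricalMeasure.
Local Open Scope ereal_scope.
Context {d} {T : measurableType d} {R : realType}.
Variables (n : nat) (y y' : nat -> T).

Let scale_ge0 : (0 <= (2 * n.+1%:R)^-1 :> R)%R.
Proof. by rewrite invr_ge0 mulr_ge0. Qed.

(** The uniform measure on the 2(n + 1) points, counted with multiplicity; the successor keeps the
    normalization from dividing by zero. *)
Definition paired_measure : set T -> \bar R :=
  mscale (NngNum scale_ge0)
    (msum (fun j => measure_add (dirac (y j)) (dirac (y' j))) n.+1).

HB.instance Definition _ := Measure.on paired_measure.

(** Stated for any set containing the points, since it serves twice: with [setT] for the total mass,
    and with the finite set of points for membership in [finitely_supported]. *)
Lemma paired_measure_eq1 (A : set T) :
  (forall j, (j <= n)%N -> A (y j)) -> (forall j, (j <= n)%N -> A (y' j)) -> paired_measure A = 1.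
Proof.
move=> Ay Ay'; rewrite /paired_measure /mscale /= /msum.
rewrite (eq_bigr (fun=> 2%:E)) => [|k _]; last first.
  have kn : (k <= n)%N by rewrite -ltnS.
  by rewrite [LHS]measure_addE /= !diracE !mem_set//; [exact: Ay'|exact: Ay].
rewrite sumEFin -EFinM; congr EFin; rewrite sumr_const card_ord -mulr_natr.
field; rewrite ?pnatr_eq0//.
Qed.

HB.instance Definition _ := Measure_isProbability.Build _ _ _
  paired_measure (@paired_measure_eq1 setT (fun _ _ => I) (fun _ _ => I)).

Definition paired_probability : probability T R := paired_measure.

Lemma Lnorm2_paired (h : T -> R) : measurable_fun setT h ->
  Lnorm paired_probability 2%:E (fun z => (h z)%:E)
  = (Num.sqrt (pair_sqr n.+1 y y' h / (2 * n.+1%:R)))%:E.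
Proof.
move=> mh; rewrite unlock.
have -> : (\int[paired_probability]_z `|(h z)%:E| `^ 2)
    = (pair_sqr n.+1 y y' h / (2 * n.+1%:R))%:E.
  have mh2 : measurable_fun setT (fun z => (h z ^+ 2)%:E).
    by apply/measurable_EFinP; exact: measurable_funX.
  have h2 z : setT z -> 0 <= (h z ^+ 2)%:E by rewrite lee_fin sqr_ge0.
  under eq_integral.
    move=> z _; rewrite poweR_EFin powR_mulrn// -normrX ger0_norm ?sqr_ge0//.
    over.
  rewrite ge0_integral_mscale//= ge0_integral_measure_sum//=.
  under eq_bigr do rewrite ge0_integral_measure_add// !integral_dirac//
    !diracT !mul1e -EFinD.
  by rewrite sumEFin -EFinM mulrC.
by rewrite poweR_EFin powR12_sqrt// divr_ge0 ?pair_sqr_ge0 ?mulr_ge0.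
Qed.

End EmpiricalMeasure.

(** * Bounding an integral from below by steps *)

Section StepBound.
Local Open Scope ereal_scope.
Context {d} {T : measurableType d} {R : realType}.
Variable mu : {measure set T -> \bar R}.

(** The integral of a nonnegative function is a supremum over simple functions below it, so
    monotonicity requires no measurability. This matters for the entropy integrand, a supremum over
    uncountably many measures. *)
Lemma le_integral_lower (D : set T) (f g : T -> \bar R) :
  (forall x, D x -> 0 <= f x) -> (forall x, D x -> f x <= g x) ->
  \int[mu]_(x in D) f x <= \int[mu]_(x in D) g x.
Proof.
move=> f0 fg; rewrite !ge0_integralE//; last first.
  by move=> x Dx; rewrite (le_trans (f0 x Dx))// fg.
apply: ereal_sup_le => _ [h /= hf <-]; exists h => // x.
apply: le_trans (hf x) _; exact: lee_restrict.
Qed.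

Lemma le_integral_steps (D : set T) (I : nat -> set T) (r : nat -> R)
    (g : T -> \bar R) K :
  measurable D -> (forall k, measurable (I k)) -> (forall k, I k `<=` D) ->
  trivIset setT I -> (forall k, 0 <= r k)%R -> (forall x, D x -> 0 <= g x) ->
  (forall k x, (k < K)%N -> I k x -> (r k)%:E <= g x) ->
  \sum_(k < K) (r k)%:E * mu (I k) <= \int[mu]_(x in D) g x.
Proof.
move=> mD mI ID tI r0 g0 rg.
apply: le_trans (_ : \int[mu]_(x in D) (\sum_(k < K) (r k)%:E * (\1_(I k) x)%:E) <= _).
  rewrite ge0_integral_sum//.
  - rewrite le_eqVlt; apply/orP; left; apply/eqP; apply: eq_bigr => k _.
    rewrite ge0_integralZl_EFin ?integral_indic// ?setIidl//.
    by apply/measurable_EFinP; exact: measurable_indic.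
  - move=> k; apply/measurable_EFinP; apply: measurable_funM => //.
  - by move=> k x _; rewrite -EFinM lee_fin mulr_ge0.
apply: le_integral_lower => x Dx.
  by apply: sume_ge0 => k _; rewrite -EFinM lee_fin mulr_ge0.
have [[k Ikx]|nI] := pselect (exists k : 'I_K, I k x).
  rewrite (bigD1 k)//= indicE mem_set// mule1 big1 ?adde0 ?rg// => j jk.
  rewrite indicE memNset ?mule0// => Ijx.
  have jk' : val j = val k by apply: tI => //; exists x.
  by move: jk; rewrite (val_inj jk') eqxx.
rewrite big1 ?g0// => k _; rewrite indicE memNset ?mule0// => Ikx.
by apply: nI; exists k.
Qed.

End StepBound.

(** * From the entropy integral to covers at the dyadic radii *)

Section Covers.
Context {R : realType} {d : nat}.
Local Notation Rd := (borel_rV R d).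
Implicit Types (F : set (Rd -> R)) (C : Rd -> R) (Q : probability Rd R).

Lemma covering_number_attained (eta : \bar R) F Q :
  (covering_number eta F Q < +oo)%E ->
  exists N (c : 'I_N -> Rd -> R), [/\ covering_number eta F Q = N%:R%:E,
    forall i, F (c i) &
    forall h, F h -> exists i,
      (Lnorm Q 2%:E (fun z => (h z - c i z)%:E) <= eta)%E].
Proof.
move=> fin.
pose S n := exists c : 'I_n -> Rd -> R, (forall i, F (c i)) /\
  forall h, F h -> exists i,
    (Lnorm Q 2%:E (fun z => (h z - c i z)%:E) <= eta)%E.
have exS : exists n, `[< S n >].
  apply: contrapT => nS; move: fin; rewrite /covering_number.
  rewrite [X in ereal_inf X](_ : _ = set0) ?ereal_inf0 ?ltxx//.
  by apply/seteqP; split => // t [n Sn _]; exfalso; apply: nS; exists n; exact/asboolP.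
case: (ex_minnP exS) => N /asboolP[c [cF cc]] Nmin.
exists N, c; split => //; apply/eqP; rewrite eq_le; apply/andP; split.
  by apply: ereal_inf_lbound; exists N => //; exists c.
apply: le_ereal_inf_tmp => _ [n Sn <-]; rewrite lee_fin ler_nat.
by apply: Nmin; exact/asboolP.
Qed.

Lemma le_covering_number (eta eta' : \bar R) F Q : (eta <= eta')%E ->
  (covering_number eta' F Q <= covering_number eta F Q)%E.
Proof.
move=> ee; apply: ereal_inf_le_tmp => _ [n [c [cF cc]] <-]; exists n => //.
exists c; split => // h /cc[i ci]; exists i; exact: le_trans ci ee.
Qed.

Lemma covering_number_ge1 (eta : \bar R) F Q : F !=set0 ->
  (1 <= covering_number eta F Q)%E.
Proof.
move=> [h Fh]; apply: le_ereal_inf_tmp => _ [[|n] [c [_ cc]] <-].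
  by have [[]] := cc h Fh.
by rewrite lee_fin ler1n.
Qed.

Let eps (k : nat) : R := 2^-1 ^+ (k + 3).

Let cover (n : nat) (y y' : nat -> Rd) F C (k : nat) :=
  covering_number ((eps k)%:E * Lnorm (paired_probability (R := R) n y y') 2%:E (EFin \o C))%E
    F (paired_probability n y y').

(** Covering numbers decrease in the radius, so on the interval between [eps k.+1] and [eps k], of
    length [eps k / 2], the integrand is at least its value at [eps k]. The heights [r] are
    arbitrary lower bounds so that a level with an infinite covering number can be tested too. *)
Lemma entropy_integral_steps n (y y' : nat -> Rd) F C (J : R) (r : nat -> R) K :
  F !=set0 -> (entropy_integral F C (1 / 8) <= J%:E)%E ->
  (forall k, 0 <= r k) ->
  (forall k, (k < K)%N -> ((r k)%:E <= (lne (2%:E * cover n y y' F C k)) `^ (2^-1))%E) ->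
  \sum_(k < K) r k * (eps k / 2) <= J.
Proof.
move=> F0 HJ r0 rH; rewrite -lee_fin; apply: le_trans HJ.
have epsS k : eps k.+1 = eps k / 2 by rewrite /eps addSn exprS mulrC.
have eps0 k : 0 < eps k by rewrite exprn_gt0.
pose I k := `]eps k.+1, eps k[%classic.
have muI k : lebesgue_measure (I k) = (eps k / 2)%:E.
  rewrite lebesgue_measure_itv/= lte_fin epsS ltr_pdivrMr// ltr_pMr// ltr1n.
  by rewrite -EFinB; congr EFin; field.
rewrite -sumEFin; under eq_bigr do rewrite EFinM -muI.
have Qfin : finitely_supported (paired_probability (R := R) n y y').
  exists (y @` `I_n.+1 `|` y' @` `I_n.+1).
    by rewrite finite_setU; split; exact: finite_image.
  by apply: paired_measure_eq1 => j jn; [left|right]; exists j.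
have ent0 (e : R) : (0 <= ereal_sup [set (lne (2%:E *
        covering_number (e%:E * Lnorm Q 2%:E (EFin \o C)) F Q)) `^ (2^-1)
      | Q in @finitely_supported R d])%E.
  by apply: le_ereal_sup_tmp; eexists; [by exists (paired_probability n y y')|exact: poweR_ge0].
apply: le_integral_steps => //.
- by move=> k; exact: measurable_itv.
- move=> k; apply: subset_itv; rewrite bnd_simp; first exact: ltW.
  apply: le_trans (_ : 2^-1 ^+ 3 <= _); last by lra.
  by apply: ler_wiXn2l; rewrite ?invr_ge0 ?invf_le1 ?ler1n// leq_addl.
- apply: ltn_trivIset => j i ij.
  apply/seteqP; split => // x; rewrite /I /=; rewrite !in_itv/= => -[/andP[xi xi2] /andP[xj xj2]]; exfalso.
  have : eps j <= eps i.+1.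
    by rewrite /eps; apply: ler_wiXn2l; rewrite ?invr_ge0 ?invf_le1 ?ler1n// leq_add2r.
  by move=> ?; lra.
move=> k e kK; rewrite /I /=; rewrite in_itv/= => /andP[_ ek].
apply: le_trans (rH k kK) _; apply: le_ereal_sup_tmp.
eexists; first by exists (paired_probability n y y').
have ge1 eta : (1 <= 2%:E * covering_number eta F (paired_probability n y y'))%E.
  have := covering_number_ge1 eta F (paired_probability n y y') F0 => h.
  by rewrite -[X in (X <= _)%E]mule1; apply: lee_pmul => //; rewrite lee_fin ?ler1n ?ler01.
apply: gt0_ler_poweR => //.
- by rewrite in_itv/= leey andbT lne_ge0 ge1.
- by rewrite in_itv/= leey andbT lne_ge0 ge1.
rewrite lee_lne ?in_itv/= ?leey ?andbT.
- rewrite lee_pmul2l//; apply: le_covering_number; apply: lee_wpmul2r => //.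
    exact: Lnorm_ge0.
  by rewrite lee_fin ltW.
- exact: le_trans (ge1 _).
- exact: le_trans (ge1 _).
Qed.

(** An infinite covering number would admit a step of any height [rho] at level [k], so
    [rho * (eps k / 2) <= J] for all [rho]; the height [2 * (|J| + 1) / eps k] contradicts this. *)
Lemma covering_number_lty n (y y' : nat -> Rd) F C (J : R) k :
  F !=set0 -> (entropy_integral F C (1 / 8) <= J%:E)%E ->
  (cover n y y' F C k < +oo)%E.
Proof.
move=> F0 HJ; rewrite ltey; apply/negP => /eqP cy.
pose r (rho : R) j : R := if j == k then rho else 0.
have H rho : 0 <= rho -> rho * (eps k / 2) <= J.
  move=> rho0; apply: le_trans (@entropy_integral_steps n y y' F C J (r rho) k.+1 F0 HJ _ _).
  - rewrite big_ord_recr/= /r eqxx lerDr sumr_ge0// => i _.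
    by case: ifP => _; rewrite mulr_ge0 ?divr_ge0 ?exprn_ge0.
  - by move=> j; rewrite /r; case: ifP.
  - move=> j _; rewrite /r; case: eqP => [->|_]; last exact: poweR_ge0.
    by rewrite cy gt0_muley ?lte_fin// [lne _]/= poweRyr ?leey// invr_neq0.
have e0 : 0 < eps k by rewrite exprn_gt0.
have pos : 0 <= 2 * (`|J| + 1) / eps k.
  by rewrite divr_ge0 ?mulr_ge0 ?addr_ge0// ltW.
have := H _ pos.
have -> : 2 * (`|J| + 1) / eps k * (eps k / 2) = `|J| + 1 by field; rewrite gt_eqF.
by have := ler_norm J; lra.
Qed.

(* The bridge from the entropy integral to the empirical process: the uniform
   entropy is used only at the empirical measure of the two samples. *)
Lemma rademacher_entropy n (y y' : nat -> Rd) F C (J : R) M (f : 'I_M -> Rd -> R) :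
  F !=set0 -> (entropy_integral F C (1 / 8) <= J%:E)%E ->
  (forall h, F h -> measurable_fun setT h) -> positive_envelope F C ->
  (forall i, F (f i)) ->
  rademacher n.+1 (max_sign_sum n.+1 (fun i => pair_diff y y' (f i)))
  <= 16 * Num.sqrt 2 * (J + 7 / 10) * Num.sqrt (2 * pair_sqr n.+1 y y' C).
Proof.
move=> F0 HJ Fm [Cm C0 FC] fF.
have eps0 k : 0 < eps k by rewrite exprn_gt0.
have [Nc HNc] := choice (fun k : nat => let: ex_intro N (ex_intro c H) :=
  covering_number_attained _ _ _ (covering_number_lty n y y' F C J k F0 HJ)
  in ex_intro (fun p : {N & 'I_N -> Rd -> R} =>
    [/\ cover n y y' F C k = (projT1 p)%:R%:E, forall i, F (projT2 p i) &
    forall h, F h -> exists i,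
      (Lnorm (paired_probability n y y') 2%:E (fun z => (h z - projT2 p i z)%:E)
        <= (eps k)%:E * Lnorm (paired_probability n y y') 2%:E (EFin \o C))%E])
    (existT _ N c) H).
have N0 k : (0 < projT1 (Nc k))%N.
  have [cN _ _] := HNc k.
  have := covering_number_ge1 ((eps k)%:E * Lnorm (paired_probability (R := R) n y y') 2%:E (EFin \o C))%E F (paired_probability n y y') F0.
  by rewrite -/(cover n y y' F C k) cN lee_fin ler1n.
apply: (@rademacher_chaining R Rd n.+1 y y' F C (fun k => projT1 (Nc k))
  (fun k => projT2 (Nc k))) => //.
- by move=> k i; have [_ cF _] := HNc k; exact: cF.
- move=> k h Fh; have [_ cF /(_ h Fh)[i H]] := HNc k; exists i.
  have hm : measurable_fun setT (fun z => h z - projT2 (Nc k) i z).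
    by apply: measurable_funB; apply: Fm.
  move: H; rewrite [X in (X <= _)%E]Lnorm2_paired// [X in (_ * X)%E]Lnorm2_paired//.
  rewrite -EFinM lee_fin -/(eps k) => H.
  have n0 : (0 : R) < 2 * n.+1%:R by rewrite mulr_gt0.
  have : Num.sqrt (pair_sqr n.+1 y y' (fun z => h z - projT2 (Nc k) i z) / (2 * n.+1%:R)) ^+ 2
     <= (eps k * Num.sqrt (pair_sqr n.+1 y y' C / (2 * n.+1%:R))) ^+ 2.
    by rewrite lerXn2r ?nnegrE ?mulr_ge0 ?sqrtr_ge0// ltW.
  rewrite exprMn !sqr_sqrtr ?divr_ge0 ?pair_sqr_ge0 ?(ltW n0)//.
  by rewrite mulrA ler_pM2r ?invr_gt0.
- move=> K; apply: (@entropy_integral_steps n y y' F C J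
    (fun k => Num.sqrt (ln (2 * (projT1 (Nc k))%:R))) K F0 HJ).
    by move=> k; exact: sqrtr_ge0.
  move=> k _; have [-> _ _] := HNc k.
  have N1 : (1 : R) <= 2 * (projT1 (Nc k))%:R.
    by rewrite -natrM ler1n muln_gt0 N0.
  rewrite -EFinM lne_EFin ?(lt_le_trans _ N1)// poweR_EFin powR12_sqrt//.
  exact: ln_ge0.
Qed.

End Covers.

(** * Laws and independence of finite samples *)

Section Samples.
Context {dT} {T : measurableType dT} {R : realType}.

Definition box n (A : 'I_n -> set T) : set (n.-tuple T) :=
  [set x | forall i, A i (tnth x i)].

Lemma box_setT n : box n (fun=> setT) = setT.
Proof. by apply/seteqP; split. Qed.

Lemma measurable_box n (A : 'I_n -> set T) : (forall i, measurable (A i)) ->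
  measurable (box n A).
Proof.
move=> mA; rewrite (_ : box n A = \bigcap_(i in [set: 'I_n]) ((@tnth n T)^~ i @^-1` A i)); last first.
  by apply/seteqP; split => [x Ax i _|x Ax i]; apply: Ax.
apply: fin_bigcap_measurable => // i _.
by rewrite -[X in measurable X]setTI; apply: measurable_tnth.
Qed.

(** Boxes are stable under intersection and generate the sigma-algebra of tuples, so the uniqueness
    theorem for finite measures applies. *)
Lemma tuple_measure_unique n (m1 m2 : {measure set (n.-tuple T) -> \bar R}) :
  (m1 setT < +oo)%E ->
  (forall A, (forall i, measurable (A i)) -> m1 (box n A) = m2 (box n A)) ->
  forall X, measurable X -> m1 X = m2 X.
Proof.
move=> m1oo m12 X mX.
pose B := [set box n A | A in [set A | forall i, measurable (A i)]].
apply: (@g_sigma_algebra_measure_unique _ _ _ B _ (fun=> setT)) => //.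
- by move=> _ [A mA <-]; exact: measurable_box.
- by move=> _; exists (fun=> setT); rewrite ?box_setT.
- by rewrite bigcup_const//; exists 0%N.
- move=> _ _ [A mA <-] [A' mA' <-]; exists (fun i => A i `&` A' i).
    by move=> i; exact: measurableI.
  apply/seteqP; split => [x Ax|x [Ax A'x] i]; last by split.
  by split=> i; have [] := Ax i.
- by move=> _ [A mA <-]; exact: m12.
- move: X mX; apply: smallest_sub; first exact: smallest_sigma_algebra.
  move=> X; rewrite -bigcup_seq => -[i _ [A mA <-]]; apply: sub_sigma_algebra.
  exists (fun j => if j == i then A else setT).
    by move=> j /=; case: ifP.
  apply/seteqP; split => [x Ax|x [_ Ax] j].
    by split=> //; have := Ax i; rewrite eqxx.
  by case: eqP => // ->.
Qed.

Context {dO} {Omega : measurableType dO} (P : probability Omega R)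
  (Q : probability T R) (Z : nat -> {RV P >-> T}).

Hypothesis Z_indep : mutually_independent P Z.
Hypothesis Z_distr : common_distribution P Z Q.

Lemma power_measure_box n (A : 'I_n -> set T) : (forall i, measurable (A i)) ->
  power_measure Q n (box n A) = (\prod_(i < n) Q (A i))%E.
Proof.
elim: n A => [|n IH] A mA /=.
  rewrite big_ord0 diracE mem_set//; by case.
rewrite big_ord_recl -(IH (fun i => A (lift ord0 i)))//.
rewrite /distribution /pushforward.
rewrite [X in (Q \x _)%E X](_ : _ = A ord0 `*` box n (fun i => A (lift ord0 i))).
  by rewrite product_measure1E//; exact: measurable_box.
apply/seteqP; split => [[x y] /= Axy|[x y] /= [Ax Ay] i].
  split; first exact: (Axy ord0).
  by move=> i; have := Axy (lift ord0 i); rewrite tnthS.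
have [j ->|->] := unliftP ord0 i; last exact: Ax.
by rewrite tnthS; exact: Ay.
Qed.

Definition sample n (s : 'I_n -> nat) (w : Omega) : n.-tuple T :=
  [tuple Z (s i) w | i < n].

Lemma measurable_sample n (s : 'I_n -> nat) : measurable_fun setT (sample n s).
Proof.
apply/measurable_fun_tnthP => i; rewrite (_ : _ \o _ = Z (s i)).
  exact: measurable_funP.
by apply/funext => w /=; rewrite tnth_mktuple.
Qed.

Lemma measurable_sample_preimage n (s : 'I_n -> nat) X : measurable X ->
  measurable (sample n s @^-1` X).
Proof.
by move=> mX; rewrite -[X in measurable X]setTI; apply: measurable_sample.
Qed.

Lemma prob_sample_box n (s : 'I_n -> nat) (A : 'I_n -> set T) : injective s ->
  (forall i, measurable (A i)) ->
  P (sample n s @^-1` box n A) = (\prod_(i < n) Q (A i))%E.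
Proof.
move=> sI mA.
(* Independence is stated for families indexed by all of nat. By injectivity of [s] the intersection
   is [A i] at [s i]; it is empty, hence [setT], at indices that are not sampled. *)
pose A' (j : nat) : set T := \bigcap_(i in [set i : 'I_n | s i = j]) A i.
have mA' j : measurable (A' j).
  by apply: fin_bigcap_measurable => //; exact: finite_finset.
have A's i : A' (s i) = A i.
  apply/seteqP; split => [x|x Aix j /= /sI -> //].
  by apply.
have := Z_indep [seq s i | i <- index_enum 'I_n] A' _ mA'.
rewrite map_inj_uniq// index_enum_uniq => /(_ isT).
rewrite big_map.
under eq_bigr => i _.
  rewrite Z_distr ?A's; last exact: mA.
  over.
move=> <-; congr (P _).
apply/seteqP; split => [w Aw|w Aw i] /=.
  move=> j /= /mapP[i _ ->]; rewrite A's; have := Aw i.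
  by rewrite tnth_mktuple.
rewrite tnth_mktuple -A's; apply: Aw => /=.
by apply: map_f; rewrite mem_index_enum.
Qed.

(** Every injective choice of indices gives the same law. This is the exchangeability behind
    symmetrization, and it also transports the null sets of the separability assumption to
    [Omega]. *)
Lemma prob_sample n (s : 'I_n -> nat) X : injective s -> measurable X ->
  P (sample n s @^-1` X) = power_measure Q n X.
Proof.
move=> sI mX.
pose f : {mfun Omega >-> n.-tuple T} := HB.pack_for {mfun Omega >-> n.-tuple T}
   (sample n s) (isMeasurableFun.Build _ _ _ _ _ (measurable_sample n s)).
apply: (tuple_measure_unique n (distribution P f) (power_measure Q n)) => //.
  by rewrite /= /distribution /pushforward preimage_setT probability_setT ltry.
move=> A mA.
exact: etrans (prob_sample_box _ _ _ sI mA) (esym (power_measure_box _ _ mA)).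
Qed.

(** For boxes the two samples are concatenated into one sample of size n + n. The extension to
    measurable sets goes one argument at a time: with the event [E] of the other sample fixed, both
    sides are finite measures in the remaining set. *)
Lemma prob_sample_indep n (s s' : 'I_n -> nat) X Y :
  injective s -> injective s' -> (forall i j, s i <> s' j) ->
  measurable X -> measurable Y ->
  P (sample n s @^-1` X `&` sample n s' @^-1` Y)
  = (P (sample n s @^-1` X) * P (sample n s' @^-1` Y))%E.
Proof.
move=> sI s'I ss' mX mY.
have boxes A B : (forall i, measurable (A i)) -> (forall i, measurable (B i)) ->
    P (sample n s @^-1` box n A `&` sample n s' @^-1` box n B)
    = (P (sample n s @^-1` box n A) * P (sample n s' @^-1` box n B))%E.
  move=> mA mB; rewrite !prob_sample_box//.
  pose u (i : 'I_(n + n)) := match fintype.split i with inl j => s j | inr j => s' j end.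
  pose C (i : 'I_(n + n)) := match fintype.split i with inl j => A j | inr j => B j end.
  have uI : injective u.
    move=> i j; rewrite /u -{2}(splitK i) -{2}(splitK j).
    case: (fintype.split i) => a; case: (fintype.split j) => b /=.
    - by move=> /sI ->.
    - by move=> /ss'.
    - by move=> /esym /ss'.
    - by move=> /s'I ->.
  have mC i : measurable (C i) by rewrite /C; case: fintype.split.
  have := prob_sample_box (n + n) u C uI mC.
  rewrite big_split_ord/=.
  under eq_bigr do rewrite /C (unsplitK (inl _)).
  under [X in (_ * X)%E]eq_bigr do rewrite /C (unsplitK (inr _)).
  move=> <-; congr (P _); apply/seteqP; split => w /=.
    move=> [Aw Bw] i; rewrite tnth_mktuple /C /u.
    case: (fintype.split i) => j; first by have := Aw j; rewrite tnth_mktuple.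
    by have := Bw j; rewrite tnth_mktuple.
  move=> Cw; split => i; rewrite tnth_mktuple.
    by have := Cw (lshift n i); rewrite tnth_mktuple /C /u (unsplitK (inl _)).
  by have := Cw (rshift n i); rewrite tnth_mktuple /C /u (unsplitK (inr _)).
have fin A : measurable A -> P A \is a fin_num by move=> mA; exact: fin_num_measure.
have step (t : 'I_n -> nat) (E : set Omega) : measurable E ->
    (forall A, (forall i, measurable (A i)) ->
      P (sample n t @^-1` box n A `&` E) = (P (sample n t @^-1` box n A) * P E)%E) ->
    forall X, measurable X ->
      P (sample n t @^-1` X `&` E) = (P (sample n t @^-1` X) * P E)%E.
  move=> mE H W mW.
  pose f : {mfun Omega >-> n.-tuple T} := HB.pack_for {mfun Omega >-> n.-tuple T}
    (sample n t) (isMeasurableFun.Build _ _ _ _ _ (measurable_sample n t)).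
  have pE0 : 0 <= fine (P E) by rewrite fine_ge0.
  have E2 V : mscale (NngNum pE0) (distribution P f) V
      = (P (sample n t @^-1` V) * P E)%E.
    by rewrite /mscale -[X in (_ = _ * X)%E](fineK (fin E mE)) muleC.
  rewrite -E2; apply: (tuple_measure_unique n (pushforward (mrestr P mE) f)
    (mscale (NngNum pE0) (distribution P f))) => //.
    by rewrite /= /pushforward /mrestr preimage_setT setTI ltey_eq fin.
  by move=> A mA; exact: etrans (H A mA) (esym (E2 _)).
apply: (step) => //; first exact: measurable_sample_preimage.
move=> A mA; rewrite setIC muleC; apply: (step) => //.
  by apply: measurable_sample_preimage; exact: measurable_box.
by move=> B mB; rewrite setIC muleC boxes.
Qed.

End Samples.

(** * Level sets and Markov's inequality *)

Section MeasurableLevelSets.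
Context {d} {T : measurableType d} {R : realType}.
Implicit Types (f : T -> R) (c : R).

Lemma measurable_gt_set f c : measurable_fun setT f ->
  measurable [set x | c < f x].
Proof.
move=> mf; rewrite -[X in measurable X]setTI.
exact: (measurable_fun_ltr (f := fun=> c) (g := f)).
Qed.

Lemma measurable_le_set f c : measurable_fun setT f ->
  measurable [set x | f x <= c].
Proof.
move=> mf; rewrite (_ : mkset _ = ~` [set x | c < f x]).
  by apply: measurableC; exact: measurable_gt_set.
by apply/seteqP; split => x /=; rewrite leNgt => /negP.
Qed.

Lemma prob_gt_le (P : probability T R) f c v :
  measurable_fun setT f -> (forall x, 0 <= f x) -> 0 < c ->
  (\int[P]_x (f x)%:E <= v%:E)%E ->
  (P [set x | (c < f x)%R] <= (v / c)%:E)%E.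
Proof.
move=> mf f0 c0 fv; have mA := measurable_gt_set f c mf.
rewrite mulrC EFinM lee_pdivlMl//; apply: le_trans fv.
apply: le_trans (_ : \int[P]_x (c%:E * (\1_[set x | (c < f x)%R] x)%:E) <= _)%E.
  rewrite ge0_integralZl_EFin ?integral_indic ?setIT// ?ltW//.
  by apply/measurable_EFinP; exact: measurable_indic.
apply: ge0_le_integral => //.
- by move=> x _; rewrite -EFinM lee_fin mulr_ge0// ltW.
- apply/measurable_EFinP; apply: measurable_funM => //; exact: measurable_indic.
- exact/measurable_EFinP.
move=> x _; rewrite -EFinM lee_fin indicE.
by have [/[!inE] /ltW|_] := boolP (x \in _); rewrite ?mulr1 ?mulr0.
Qed.

End MeasurableLevelSets.

(** * First and second moments of the sample *)

Section Moments.
Context {dT} {T : measurableType dT} {R : realType}.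
Context {dO} {Omega : measurableType dO} (P : probability Omega R)
  (Q : probability T R) (Z : nat -> {RV P >-> T}).

Hypothesis Z_indep : mutually_independent P Z.
Hypothesis Z_distr : common_distribution P Z Q.

Lemma ge0_integral_Z (g : T -> \bar R) j : measurable_fun setT g ->
  (forall z, 0 <= g z)%E -> (\int[P]_w g (Z j w) = \int[Q]_z g z)%E.
Proof.
move=> mg g0; rewrite -(ge0_integral_distribution (Z j) mg g0).
by apply: eq_measure_integral => A mA _; exact: Z_distr.
Qed.

Lemma integrable_Z (g : T -> R) j : Q.-integrable setT (EFin \o g) ->
  P.-integrable setT (EFin \o (g \o Z j)).
Proof.
move=> /integrableP[/measurable_EFinP mg ig]; apply/integrableP; split.
  by apply/measurable_EFinP; apply: measurableT_comp.
rewrite [X in (X < _)%E](@ge0_integral_Z (fun z => `|(g z)%:E|%E) j)//.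
by apply: measurableT_comp => //; exact/measurable_EFinP.
Qed.

Lemma integral_Z (g : T -> R) j : Q.-integrable setT (EFin \o g) ->
  (\int[P]_w (g (Z j w))%:E = \int[Q]_z (g z)%:E)%E.
Proof.
move=> ig; rewrite -[LHS](@integral_distribution _ _ _ _ _ P (Z j) (EFin \o g)).
- by apply: eq_measure_integral => A mA _; exact: Z_distr.
- by have /integrableP[] := ig.
- exact: integrable_Z.
Qed.

(** Independence identifies the law of [(Z i, Z j)] with the product [Q \x Q] on rectangles, hence
    everywhere; Fubini's theorem then factors the integral. *)
Lemma integral_ZM (g : T -> R) i j : i != j -> Q.-integrable setT (EFin \o g) ->
  (\int[P]_w (g (Z i w) * g (Z j w))%:E
   = (\int[Q]_z (g z)%:E) * (\int[Q]_z (g z)%:E))%E.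
Proof.
move=> ij ig; have /integrableP[/measurable_EFinP mg ltg] := ig.
pose V w := (Z i w, Z j w).
have mV : measurable_fun setT V by apply: measurable_fun_pair.
pose f : {mfun Omega >-> (T * T)%type} := HB.pack_for {mfun Omega >-> (T * T)%type}
   V (isMeasurableFun.Build _ _ _ _ _ mV).
have law X : measurable X -> (Q \x Q)%E X = distribution P f X.
  apply: product_measure_unique => A B mA mB.
  pose A' k := if k == i then A else B.
  have := Z_indep [:: i; j] A' _ _; rewrite /= inE ij => /(_ isT).
  rewrite !big_cons big_nil mule1 /A' eqxx eq_sym (negbTE ij) !Z_distr// => <-.
    congr (P _); apply/seteqP; split => [w [/= Aw Bw] k /=|w Aw].
      by rewrite !inE => /orP[] /eqP ->; rewrite ?eqxx// eq_sym (negbTE ij).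
    have := Aw i; have := Aw j; rewrite /= !inE !eqxx orbT eq_sym (negbTE ij).
    by move=> /(_ isT) Bw /(_ isT) Aiw; split.
  by move=> k; case: ifP.
pose G (z : T * T) : \bar R := (g z.1 * g z.2)%:E.
have mG : measurable_fun setT G.
  by apply/measurable_EFinP; apply: measurable_funM; apply: measurableT_comp.
have fing : (\int[Q]_z (g z)%:E)%E \is a fin_num by exact: integrable_fin_num.
have iG : (Q \x Q)%E.-integrable setT G.
  apply/integrable12ltyP => //.
  under eq_integral => x _.
    under eq_integral => y _ do rewrite /G /= normrM EFinM.
    rewrite ge0_integralZl_EFin//; last by apply/measurable_EFinP; exact: measurableT_comp.
    over.
  rewrite ge0_integralZr//; last 2 first.
    by apply/measurable_EFinP; exact: measurableT_comp.
    exact: integral_ge0.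
  have g0 : (0 <= \int[Q]_z `|(g z)%:E|)%E by exact: integral_ge0.
  by apply: lte_mul_pinfty => //; rewrite ge0_fin_numE.
have lawI (H : T * T -> \bar R) :
    (\int[distribution P f]_z H z = \int[(Q \x Q)%E]_z H z)%E.
  by apply: eq_measure_integral => A mA _; exact/esym/law.
have iGf : P.-integrable setT (G \o f).
  apply/integrableP; split; first exact: measurableT_comp.
  rewrite -[X in (X < _)%E](@ge0_integral_distribution _ _ _ _ _ P f (abse \o G)); last 2 first.
  - by apply: measurableT_comp.
  - by move=> y; exact: abse_ge0.
  by rewrite lawI; have /integrableP[] := iG.
transitivity (\int[distribution P f]_z G z)%E.
  by rewrite (integral_distribution mG iGf).
rewrite lawI -integral12_prod_meas1//.
under eq_integral => x _.
  rewrite /fubini_F /G /=.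
  under eq_integral do rewrite EFinM.
  rewrite integralZl//.
  over.
by rewrite -(fineK fing) integralZr// fineK.
Qed.

(* For independent samples the cross terms vanish, so the variance of the sum
   is the sum of the variances. *)
Lemma sum_Z_sqr_le n (s : 'I_n -> nat) (h xi : T -> R) (mu : R) :
  injective s -> measurable_fun setT h -> (forall z, `|h z| <= xi z) ->
  measurable_fun setT xi -> (\int[Q]_z (xi z ^+ 2)%:E <= (mu ^+ 2)%:E)%E ->
  (\int[P]_w ((\sum_(j < n) (h (Z (s j) w) - fine (\int[Q]_z (h z)%:E)%E)) ^+ 2)%:E
  <= (n%:R * mu ^+ 2)%:E)%E.
Proof.
move=> sI mh hxi mxi xi2.
set m := fine _; pose g z := h z - m.
have mg : measurable_fun setT g by apply: measurable_funB.
have ih2 : Q.-integrable setT (EFin \o (fun z => h z ^+ 2)).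
  apply/integrableP; split; first by apply/measurable_EFinP; exact: measurable_funX.
  apply: le_lt_trans (ltry (mu ^+ 2)); apply: le_trans xi2.
  apply: ge0_le_integral => //.
  - by apply/measurableT_comp => //; apply/measurable_EFinP; exact: measurable_funX.
  - by apply/measurable_EFinP; exact: measurable_funX.
  move=> z _ /=; rewrite lee_fin normrX lerXn2r ?nnegrE//.
  exact: le_trans (hxi z).
have i1 c : Q.-integrable setT (EFin \o (fun=> c : R)).
  by apply: finite_measure_integrable_cst.
have icst (c : R) : (\int[Q]_z c%:E = c%:E)%E.
  by rewrite -[RHS](expectation_cst Q c) unlock.
have ih : Q.-integrable setT (EFin \o h).
  apply: (@le_integrable _ _ _ _ _ _ _ (EFin \o (fun z => 1 + h z ^+ 2))) => //.
  - exact/measurable_EFinP.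
  - move=> z _ /=; rewrite lee_fin [X in _ <= X]ger0_norm ?addr_ge0 ?sqr_ge0//.
    have := sqr_ge0 (h z).
    by have := sqr_ge0 (`|h z| - 1); rewrite sqrrB real_normK ?num_real//; lra.
  - exact: (integrableD _ (i1 1) ih2).
have fh : (\int[Q]_z (h z)%:E)%E = m%:E by rewrite fineK// integrable_fin_num.
have ig : Q.-integrable setT (EFin \o g) by exact: (integrableB _ ih (i1 m)).
have g0 : (\int[Q]_z (g z)%:E = 0)%E.
  under eq_integral do rewrite EFinB.
  by rewrite integralB_EFin// fh icst subee.
have g2E z : g z ^+ 2 = h z ^+ 2 + ((- 2 * m) * h z + m ^+ 2) by rewrite /g; ring.
have ig2' : Q.-integrable setT (EFin \o (fun z => (- 2 * m) * h z + m ^+ 2)).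
  exact: (integrableD measurableT (integrableZl measurableT (- 2 * m) ih)
    (i1 (m ^+ 2))).
have ig2 : Q.-integrable setT (EFin \o (fun z => g z ^+ 2)).
  apply: eq_integrable (integrableD _ ih2 ig2') => // z _ /=.
  by rewrite g2E.
have Eg2 : (\int[Q]_z (g z ^+ 2)%:E <= (mu ^+ 2)%:E)%E.
  under eq_integral do rewrite g2E EFinD.
  rewrite integralD_EFin//.
  under [X in (_ + X)%E]eq_integral do rewrite /= EFinD.
  rewrite integralD_EFin//; last exact: (integrableZl measurableT (- 2 * m) ih).
  under [X in (_ + (X + _))%E]eq_integral do rewrite /= EFinM.
  rewrite integralZl// fh icst -EFinM -EFinD.
  apply: le_trans (_ : \int[Q]_z (h z ^+ 2)%:E <= _)%E.
    rewrite -[leRHS]adde0 leeD2l// lee_fin; have := sqr_ge0 m; lra.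
  apply: le_trans xi2; apply: ge0_le_integral => //.
  - by move=> z _; rewrite lee_fin sqr_ge0.
  - by apply/measurable_EFinP; exact: measurable_funX.
  - by apply/measurable_EFinP; exact: measurable_funX.
  move=> z _; rewrite lee_fin -[leLHS]ger0_norm ?sqr_ge0// normrX lerXn2r ?nnegrE//.
  exact: le_trans (hxi z).
have iP i j : P.-integrable setT (EFin \o (fun w => g (Z (s i) w) * g (Z (s j) w))).
  have P2 k := integrable_Z _ k ig2.
  apply: (le_integrable _ _ _ (integrableD _ (P2 (s i)) (P2 (s j)))) => //.
    apply/measurable_EFinP; apply: measurable_funM; exact: measurableT_comp.
  move=> w _ /=; rewrite lee_fin normrM [leRHS]ger0_norm ?addr_ge0 ?sqr_ge0//.
  have := sqr_ge0 (`|g (Z (s i) w)| - `|g (Z (s j) w)|).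
  rewrite sqrrB !real_normK ?num_real//.
  have := sqr_ge0 (g (Z (s i) w)); have := sqr_ge0 (g (Z (s j) w)); lra.
under eq_integral => w _.
  rewrite expr2 mulr_suml -sumEFin.
  under eq_bigr do rewrite mulr_sumr -sumEFin.
  over.
rewrite integral_sum//; last first.
  by move=> i; apply: integrable_sum => // j _; exact: iP.
rewrite -[n in leRHS]card_ord mulr_natl -sumr_const -sumEFin; apply: lee_sum => i _.
rewrite integral_sum//; last by move=> j; exact: iP.
rewrite (bigD1 i)//= big1 ?adde0 => [|j ji].
  apply: le_trans Eg2; rewrite -(integral_Z _ (s i) ig2) le_eqVlt.
  by apply/orP; left; apply/eqP; apply: eq_integral => w _; rewrite expr2.
have sij : s i != s j by apply: contra_neq ji => /sI.
by have := integral_ZM _ _ _ sij ig; rewrite g0 mule0.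
Qed.

Lemma prob_sum_Z_le n (s : 'I_n -> nat) (h xi : T -> R) (mu u : R) :
  injective s -> measurable_fun setT h -> (forall z, `|h z| <= xi z) ->
  measurable_fun setT xi -> (\int[Q]_z (xi z ^+ 2)%:E <= (mu ^+ 2)%:E)%E ->
  0 < u ->
  (P [set w | (u < `|\sum_(j < n) (h (Z (s j) w) - fine (\int[Q]_z (h z)%:E)%E)|)%R]
   <= (n%:R * mu ^+ 2 / u ^+ 2)%:E)%E.
Proof.
move=> sI mh hxi mxi xi2 u0.
have := sum_Z_sqr_le n s h xi mu sI mh hxi mxi xi2.
set m := fine _; set S := fun w => \sum_(j < n) (h (Z (s j) w) - m).
rewrite -/S => H.
have mS : measurable_fun setT S.
  apply: measurable_sum => j; apply: measurable_funB => //; exact: measurableT_comp.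
rewrite (_ : mkset _ = [set w | u ^+ 2 < S w ^+ 2]).
  apply: prob_gt_le => //; last exact: exprn_gt0.
  - exact: measurable_funX.
  - by move=> w; exact: sqr_ge0.
apply/seteqP; split => w /=; rewrite -[S w ^+ 2]real_normK ?num_real//.
  by move=> uS; rewrite ltrXn2r ?nnegrE// ltW.
by rewrite ltr_pXn2r ?nnegrE// ltW.
Qed.

End Moments.

(** * Tools for symmetrization: first hits, measurability, averaging over signs *)

Section Symmetrization.
Context {R : realType}.

(* The sets [seqDU A k], "k is the first index that is hit", are disjoint. *)
Lemma prob_bigsetU_indep_le {d} {T : measurableType d} (P : probability T R)
    (A E : nat -> set T) M :
  (forall k, measurable (A k)) -> (forall k, measurable (E k)) ->
  (forall k, P (seqDU A k `&` E k) = P (seqDU A k) * P (E k))%E ->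
  (forall k, 2^-1%:E <= P (E k))%E ->
  (P (\big[setU/set0]_(k < M) A k)
   <= 2%:E * P (\big[setU/set0]_(k < M) (A k `&` E k)))%E.
Proof.
move=> mA mE indep E2.
have mD k : measurable (seqDU A k).
  by apply: measurableD => //; exact: bigsetU_measurable.
have tD : trivIset setT (fun k => seqDU A k `&` E k).
  by apply: trivIset_setIr; exact: trivIset_seqDU.
have e1 : (P (\big[setU/set0]_(k < M) seqDU A k) = \sum_(k < M) P (seqDU A k))%E.
  exact: measure_bigsetU.
have e2 : (P (\big[setU/set0]_(k < M) (seqDU A k `&` E k))
    = \sum_(k < M) P (seqDU A k `&` E k))%E.
  exact: (measure_bigsetU P (fun k => measurableI _ _ (mD k) (mE k)) tD M).
rewrite bigsetU_seqDU e1.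
apply: le_trans (_ : 2%:E * P (\big[setU/set0]_(k < M) (seqDU A k `&` E k)) <= _)%E.
  rewrite e2.
  rewrite ge0_sume_distrr//; apply: lee_sum => k _.
  rewrite indep muleCA -[leLHS]mule1 lee_wpmul2l//.
  by rewrite -lee_pdivrMl// mule1.
rewrite lee_pmul2l//; apply: le_measure; rewrite ?inE.
- by apply: bigsetU_measurable => k _; exact: measurableI.
- by apply: bigsetU_measurable => k _; exact: measurableI.
- rewrite -(bigcup_mkord _ (fun k => seqDU A k `&` E k)).
  rewrite -(bigcup_mkord _ (fun k => A k `&` E k)); apply: subset_bigcup => k _.
  by apply: setSI; exact: subset_seqDU.
Qed.

Lemma measurable_max_sign_sum {d} {T : measurableType d} n N
    (g : T -> 'I_N -> nat -> R) s :
  (forall i j, measurable_fun setT (fun x => g x i j)) ->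
  measurable_fun setT (fun x => max_sign_sum n (g x) s).
Proof.
move=> mg; rewrite /max_sign_sum.
have {mg} : forall i, measurable_fun setT (fun x => `|sign_sum n (g x i) s|).
  move=> i; apply: measurableT_comp => //; apply: measurable_sum => j.
  exact: measurable_funM.
elim: N g => [|N IH] g mg.
  by under eq_fun do rewrite big_ord0; exact: measurable_cst.
under eq_fun do rewrite big_ord_recl.
apply: measurable_maxr; first exact: mg.
by apply: (IH (fun x i => g x (lift ord0 i))) => i; exact: mg.
Qed.

Lemma measurable_pair_diff {d d'} {O : measurableType d} {T : measurableType d'}
    (y y' : O -> nat -> T) (h : T -> R) j :
  measurable_fun setT (fun x => y x j) -> measurable_fun setT (fun x => y' x j) ->
  measurable_fun setT h -> measurable_fun setT (fun x => pair_diff (y x) (y' x) h j).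
Proof.
by move=> my my' mh; apply: measurable_funB;
  [exact: (measurableT_comp mh my)|exact: (measurableT_comp mh my')].
Qed.

Lemma measurable_pair_sqr {d d'} {O : measurableType d} {T : measurableType d'}
    n (y y' : O -> nat -> T) (h : T -> R) :
  (forall j, measurable_fun setT (fun x => y x j)) ->
  (forall j, measurable_fun setT (fun x => y' x j)) ->
  measurable_fun setT h -> measurable_fun setT (fun x => pair_sqr n (y x) (y' x) h).
Proof.
move=> my my' mh; apply: measurable_sum => j; apply: measurable_funD;
  apply: measurable_funX;
  [exact: (measurableT_comp mh (my j))|exact: (measurableT_comp mh (my' j))].
Qed.

Lemma measurable_nth_tuple {d} {T : measurableType d} n j :
  measurable_fun setT (fun t : n.-tuple T => nth point t j).
Proof.
have [jn|nj] := ltnP j n.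
  rewrite (_ : (fun t => _) = (fun t : n.-tuple T => tnth t (Ordinal jn))).
    exact: measurable_tnth.
  by apply/funext => t; rewrite (tnth_nth point).
rewrite (_ : (fun t => _) = cst point); first exact: measurable_cst.
by apply/funext => t; rewrite nth_default// size_tuple.
Qed.

Lemma rademacher_ge0 n (g : seq bool -> R) : (forall s, 0 <= g s) ->
  0 <= rademacher n g.
Proof.
move=> g0; rewrite -(rademacher_cst n (0 : R)).
by apply: le_rademacher => s _; exact: g0.
Qed.

Lemma measurable_rademacher_indic {d} {T : measurableType d} n
    (G : seq bool -> set T) : (forall s, measurable (G s)) ->
  measurable_fun setT (fun x => rademacher n (fun s => \1_(G s) x : R)).
Proof.
elim: n G => [|n IH] G mG /=; first exact: measurable_indic.
by apply: measurable_funM => //; apply: measurable_funD; exact: IH.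
Qed.

Lemma integral_rademacher_indic {d} {T : measurableType d}
    (P : probability T R) n (G : seq bool -> set T) :
  (forall s, measurable (G s)) ->
  (\int[P]_x (rademacher n (fun s => \1_(G s) x))%:E
   = (rademacher n (fun s => fine (P (G s))))%:E)%E.
Proof.
elim: n G => [|n IH] G mG /=.
  by rewrite integral_indic// setIT fineK// fin_num_measure.
under eq_integral do rewrite mulrC EFinM EFinD.
have ge0 b x : (0 <= (rademacher n (fun s => \1_(G (b :: s)) x) : R)%:E)%E.
  by rewrite lee_fin rademacher_ge0.
have mb b : measurable_fun setT
    (fun x => (rademacher n (fun s => \1_(G (b :: s)) x) : R)%:E).
  by apply/measurable_EFinP; exact: measurable_rademacher_indic.
rewrite ge0_integralZl_EFin//; last 2 first.
- by move=> x _; rewrite adde_ge0.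
- exact: emeasurable_funD.
rewrite ge0_integralD// (IH (fun s => G (true :: s)))// (IH (fun s => G (false :: s)))//.
by rewrite -EFinD -EFinM mulrC.
Qed.

End Symmetrization.

(** * Symmetrization with the ghost sample *)

Section Ghost.
Context {dT} {T : measurableType dT} {R : realType}.
Context {dO} {Omega : measurableType dO} (P : probability Omega R)
  (Q : probability T R) (Z : nat -> {RV P >-> T}).

Hypothesis Z_indep : mutually_independent P Z.
Hypothesis Z_distr : common_distribution P Z Q.

Variables (n M : nat) (f : nat -> T -> R) (xi : T -> R).
Hypothesis f_meas : forall k, measurable_fun setT (f k).
Hypothesis xi_meas : measurable_fun setT xi.

(** The flag [c] says whether the squared envelope must also stay below [V]. The Markov bound uses
    [false], the exponential bound [true], and one symmetrization argument covers both. *)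
Definition symmetrized_event (c : bool) (u V : R) (y y' : nat -> T) s : bool :=
  (u < max_sign_sum n (fun i : 'I_M => pair_diff y y' (f i)) s) &&
  (c ==> (pair_sqr n y y' xi <= V)).

Lemma measurable_symmetrized_event {d} {O : measurableType d} c u V s
    (y y' : O -> nat -> T) :
  (forall j, measurable_fun setT (fun x => y x j)) ->
  (forall j, measurable_fun setT (fun x => y' x j)) ->
  measurable [set x | symmetrized_event c u V (y x) (y' x) s].
Proof.
move=> my my'.
rewrite (_ : mkset _ = [set x | u < max_sign_sum n
     (fun i : 'I_M => pair_diff (y x) (y' x) (f i)) s]
   `&` (if c then [set x | pair_sqr n (y x) (y' x) xi <= V] else setT)).
  apply: measurableI.
    apply: measurable_gt_set; apply: measurable_max_sign_sum => i j.
    exact: measurable_pair_diff.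
  by case: c => //; apply: measurable_le_set; exact: measurable_pair_sqr.
apply/seteqP; split => x /=; rewrite /symmetrized_event; case: c => /=.
- by move=> /andP[].
- by rewrite andbT.
- by move=> [-> ->].
- by rewrite andbT => -[].
Qed.

(** Slots j and n + j of the double sample receive Z_j and Z_(n+j), in this order if the j-th sign
    is [true] and exchanged otherwise. Injectivity is all that the law of a sample requires. *)
Let swap s (i : 'I_(n + n)) : nat :=
  match fintype.split i with
  | inl j => if nth false s j then j : nat else (n + j)%N
  | inr j => if nth false s j then (n + j)%N else j : nat
  end.

Let swap_inj s : injective (swap s).
Proof.
move=> i j; rewrite /swap -{2}(splitK i) -{2}(splitK j).
have addn_neq (a b : 'I_n) : (a : nat) = (n + b)%N -> False.
  by move=> ab; have := ltn_ord a; rewrite ab ltnNge leq_addr.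
case: (fintype.split i) => a; case: (fintype.split j) => b /=.
- case: ifP => sa; case: ifP => sb.
  + by move=> /val_inj ->.
  + by move=> /addn_neq.
  + by move=> /esym/addn_neq.
  + by move=> /addnI/val_inj ->.
- case: ifP => sa; case: ifP => sb.
  + by move=> /addn_neq.
  + by move=> ab; move: sa; rewrite ab sb.
  + by move=> /addnI ab; move: sa; rewrite ab sb.
  + by move=> /esym/addn_neq.
- case: ifP => sa; case: ifP => sb.
  + by move=> /esym/addn_neq.
  + by move=> /addnI ab; move: sa; rewrite ab sb.
  + by move=> ab; move: sa; rewrite ab sb.
  + by move=> /addn_neq.
- case: ifP => sa; case: ifP => sb.
  + by move=> /addnI/val_inj ->.
  + by move=> /esym/addn_neq.
  + by move=> /addn_neq.
  + by move=> /val_inj ->.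
Qed.

(* Exchanging Z_j with its ghost copy Z_(n+j) flips the j-th sign, and leaves
   the law of the pair of samples unchanged. *)
Lemma prob_symmetrized_event c u V s :
  P [set w | symmetrized_event c u V (fun j => Z j w) (fun j => Z (n + j)%N w) s]
  = power_measure Q (n + n) [set t | symmetrized_event c u V
      (fun j => nth point t j) (fun j => nth point t (n + j)%N) (nseq n true)].
Proof.
rewrite -(@prob_sample _ _ _ _ _ P Q Z Z_indep Z_distr _ (swap s))//; last first.
  by apply: measurable_symmetrized_event => j; exact: measurable_nth_tuple.
congr (P _); apply/seteqP.
suff H w : symmetrized_event c u V (fun j => nth point (sample P Z (n + n) (swap s) w) j)
      (fun j => nth point (sample P Z (n + n) (swap s) w) (n + j)%N) (nseq n true)
    = symmetrized_event c u V (fun j => Z j w) (fun j => Z (n + j)%N w) s.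
  by split => w /=; rewrite H.
set y := (fun j => nth point _ j); set y' := (fun j => nth point _ _).
have yE j : (j < n)%N -> y j = if nth false s j then Z j w else Z (n + j)%N w.
  move=> jn; rewrite /y -[j]/(val (lshift n (Ordinal jn))) -tnth_nth tnth_mktuple.
  by rewrite /swap (unsplitK (inl _))/=; case: ifP.
have y'E j : (j < n)%N -> y' j = if nth false s j then Z (n + j)%N w else Z j w.
  move=> jn; rewrite /y' -[(n + j)%N]/(val (rshift n (Ordinal jn))) -tnth_nth tnth_mktuple.
  by rewrite /swap (unsplitK (inr _))/=; case: ifP.
rewrite /symmetrized_event.
rewrite [pair_sqr n y y' xi](_ : _
    = pair_sqr n (fun j => Z j w) (fun j => Z (n + j)%N w) xi); last first.
  apply: eq_bigr => j _; rewrite yE// y'E//; case: ifP => // _.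
  by rewrite addrC.
rewrite [X in _ < X](_ : _ = max_sign_sum n (fun i : 'I_M =>
    pair_diff (fun j => Z j w) (fun j => Z (n + j)%N w) (f i)) s)//.
apply: eq_bigr => i _; congr `|_|; apply: eq_bigr => j _.
rewrite nth_nseq ltn_ord /pair_diff yE// y'E//.
by case: ifP => _; rewrite ?mul1r// mulN1r opprB.
Qed.

(** The probability is the same for all sign lists, hence equals its average over them. Moving the
    average inside the integral leaves, for each fixed [w], a Rademacher probability, which [phi]
    bounds. *)
Lemma prob_symmetrized_event_le c u V (phi : Omega -> R) s :
  measurable_fun setT phi ->
  (forall w, rademacher n (fun s' => (symmetrized_event c u V
     (fun j => Z j w) (fun j => Z (n + j)%N w) s')%:R) <= phi w) ->
  (P [set w | symmetrized_event c u V (fun j => Z j w) (fun j => Z (n + j)%N w) s]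
   <= \int[P]_w (phi w)%:E)%E.
Proof.
move=> mphi le_phi.
pose G s' := [set w | symmetrized_event c u V
  (fun j => Z j w) (fun j => Z (n + j)%N w) s'].
have mG s' : measurable (G s').
  by apply: measurable_symmetrized_event => j; exact: measurable_funP.
have GE : P (G s) = (rademacher n (fun s' => fine (P (G s'))))%:E.
  rewrite -[LHS]fineK ?fin_num_measure//; congr EFin.
  rewrite -[LHS](rademacher_cst n); apply: eq_rademacher => s' _.
  by rewrite !prob_symmetrized_event.
rewrite -/(G s) GE -integral_rademacher_indic//; apply: ge0_le_integral => //.
- by move=> w _; rewrite lee_fin rademacher_ge0.
- by apply/measurable_EFinP; exact: measurable_rademacher_indic.
- exact/measurable_EFinP.
- move=> w _; rewrite lee_fin; apply: le_trans (le_phi w).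
  apply: le_rademacher => s' _; rewrite indicE.
  by rewrite /G; case: (boolP (w \in _)) => [/[!inE] /= ->|//].
Qed.

Variable mu : R.
Hypothesis f_le : forall k z, `|f k z| <= xi z.
Hypothesis xi_sqr : (\int[Q]_z (xi z ^+ 2)%:E <= (mu ^+ 2)%:E)%E.

Definition centered_sum (g : T -> R) (t : n.-tuple T) : R :=
  \sum_(j < n) (g (tnth t j) - fine (\int[Q]_z (g z)%:E)%E).

Definition sum_sqr (t : n.-tuple T) : R := \sum_(j < n) xi (tnth t j) ^+ 2.

Definition deviation_event (c : bool) (U : R) k : set (n.-tuple T) :=
  [set t | U < `|centered_sum (f k) t|] `&`
  [set t | c ==> (sum_sqr t <= 2 * n%:R * mu ^+ 2)].

Lemma measurable_centered_sum g : measurable_fun setT g ->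
  measurable_fun setT (centered_sum g).
Proof.
move=> mg; apply: measurable_sum => j; apply: measurable_funB => //.
exact: (measurableT_comp mg (measurable_tnth j)).
Qed.

Lemma measurable_sum_sqr : measurable_fun setT sum_sqr.
Proof.
apply: measurable_sum => j; apply: measurable_funX.
exact: (measurableT_comp xi_meas (measurable_tnth j)).
Qed.

Lemma measurable_deviation_event c U k : measurable (deviation_event c U k).
Proof.
apply: measurableI.
  apply: measurable_gt_set; apply: measurableT_comp => //.
  exact: measurable_centered_sum.
case: c => /=; first by apply: measurable_le_set; exact: measurable_sum_sqr.
by rewrite (_ : mkset _ = setT)//; apply/seteqP; split.
Qed.

Let first_sample (i : 'I_n) : nat := i.
Let ghost_sample (i : 'I_n) : nat := n + i.

Let first_inj : injective first_sample. Proof. exact: val_inj. Qed.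
Let ghost_inj : injective ghost_sample.
Proof. by move=> i j /addnI /val_inj. Qed.
Let first_ghost i j : first_sample i <> ghost_sample j.
Proof.
by rewrite /first_sample /ghost_sample => ij; have := ltn_ord i; rewrite ij ltnNge leq_addr.
Qed.

(** The ghost sample uses up at most half of the deviation [U]. Its bound 8 on the squared envelope
    and the 2 of [deviation_event] add up to the 10 in the symmetrized event. *)
Let typical_ghost (U : R) k : set (n.-tuple T) :=
  [set t | `|centered_sum (f k) t| <= U / 2] `&`
  [set t | sum_sqr t <= 8 * n%:R * mu ^+ 2].

Let measurable_typical_ghost U k : measurable (typical_ghost U k).
Proof.
apply: measurableI; apply: measurable_le_set; last exact: measurable_sum_sqr.
by apply: measurableT_comp => //; exact: measurable_centered_sum.
Qed.

Let centered_sumE g (s : 'I_n -> nat) w : centered_sum g (sample P Z n s w)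
  = \sum_(j < n) (g (Z (s j) w) - fine (\int[Q]_z (g z)%:E)%E).
Proof. by apply: eq_bigr => j _; rewrite tnth_mktuple. Qed.

Let sum_sqrE (s : 'I_n -> nat) w : sum_sqr (sample P Z n s w)
  = \sum_(j < n) xi (Z (s j) w) ^+ 2.
Proof. by apply: eq_bigr => j _; rewrite tnth_mktuple. Qed.

(** Chebyshev's inequality at level U / 2 fails with probability at most 1/4, Markov's inequality at
    eight times the mean bound with probability at most 1/8; together 3/8, which is below 1/2. *)
Let typical_ghost_prob U k : (0 < n)%N -> 0 < mu -> 0 < U ->
  16 * n%:R * mu ^+ 2 <= U ^+ 2 ->
  (2^-1%:E <= P (sample P Z n ghost_sample @^-1` typical_ghost U k))%E.
Proof.
move=> n0 mu0 U0 U16.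
have nmu : 0 < n%:R * mu ^+ 2 by rewrite mulr_gt0 ?ltr0n ?exprn_gt0.
pose E := sample P Z n ghost_sample @^-1` typical_ghost U k.
have mE : measurable E by exact: measurable_sample_preimage.
pose B1 := [set w | U / 2 < `|\sum_(j < n) (f k (Z (ghost_sample j) w)
    - fine (\int[Q]_z (f k z)%:E)%E)|].
pose B2 := [set w | 8 * n%:R * mu ^+ 2 < \sum_(j < n) xi (Z (ghost_sample j) w) ^+ 2].
have mB1 : measurable B1.
  apply: measurable_gt_set; apply: measurableT_comp => //.
  apply: measurable_sum => j; apply: measurable_funB => //; exact: measurableT_comp.
have mS : measurable_fun setT (fun w => \sum_(j < n) xi (Z (ghost_sample j) w) ^+ 2).
  by apply: measurable_sum => j; apply: measurable_funX; exact: measurableT_comp.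
have mB2 : measurable B2 by exact: measurable_gt_set.
have PB1 : (P B1 <= (4^-1)%:E)%E.
  apply: le_trans (@prob_sum_Z_le _ _ _ _ _ _ _ Z Z_indep Z_distr n _ (f k) xi mu _
    ghost_inj (f_meas k) (f_le k) xi_meas xi_sqr _) _; first by rewrite divr_gt0.
  by rewrite lee_fin ler_pdivrMr ?exprn_gt0 ?divr_gt0// expr_div_n; lra.
have PB2 : (P B2 <= (8^-1)%:E)%E.
  apply: le_trans (@prob_gt_le _ _ _ P _ _ (n%:R * mu ^+ 2) mS _ _ _) _.
  - by move=> w; apply: sumr_ge0 => j _; exact: sqr_ge0.
  - by rewrite -mulrA mulr_gt0.
  - under eq_integral do rewrite -sumEFin.
    rewrite ge0_integral_sum//.
    + rewrite -[n in leRHS]card_ord mulr_natl -sumr_const -sumEFin; apply: lee_sum => j _.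
      rewrite (@ge0_integral_Z _ _ _ _ _ P Q Z Z_distr (fun z => (xi z ^+ 2)%:E))//.
        by apply/measurable_EFinP; exact: measurable_funX.
      by move=> z; rewrite lee_fin sqr_ge0.
    + move=> j; apply/measurable_EFinP; apply: measurable_funX; exact: measurableT_comp.
    + by move=> j w _; rewrite lee_fin sqr_ge0.
  - by rewrite lee_fin -mulrA invfM mulrCA divff ?gt_eqF// mulr1.
have CE : ~` E `<=` B1 `|` B2.
  move=> w /not_andP[]; rewrite /= ?centered_sumE ?sum_sqrE.
    by move=> /negP; rewrite -ltNge; left.
  by move=> /negP; rewrite -ltNge; right.
have : (P (~` E) <= (4^-1)%:E + (8^-1)%:E)%E.
  apply: le_trans (_ : P (B1 `|` B2) <= _)%E.
    by apply: le_measure; rewrite ?inE//; [exact: measurableC|exact: measurableU].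
  by apply: le_trans (measureU2 _ mB1 mB2) _; exact: leeD.
rewrite probability_setC// -(fineK (fin_num_measure P _ mE)) -EFinB -EFinD !lee_fin; lra.
Qed.

(* Given the first sample, its first large deviation is independent of the
   ghost sample, which is typical with probability at least 1/2. *)
Lemma prob_deviation_le c U : (0 < n)%N -> 0 < mu -> 0 < U ->
  16 * n%:R * mu ^+ 2 <= U ^+ 2 ->
  (P (\big[setU/set0]_(k < M) (sample P Z n (fun i => i) @^-1` deviation_event c U k))
   <= 2%:E * P [set w | symmetrized_event c (U / 2) (10 * n%:R * mu ^+ 2)
      (fun j => Z j w) (fun j => Z (n + j)%N w) (nseq n true)])%E.
Proof.
move=> n0 mu0 U0 U16.
pose A k := sample P Z n first_sample @^-1` deviation_event c U k.
pose E k := sample P Z n ghost_sample @^-1` typical_ghost U k.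
have mA k : measurable (A k).
  by apply: measurable_sample_preimage; exact: measurable_deviation_event.
have mE k : measurable (E k) by exact: measurable_sample_preimage.
apply: le_trans (@prob_bigsetU_indep_le _ _ _ P A E M mA mE _ _) _.
- move=> k; rewrite (_ : seqDU A k = sample P Z n first_sample @^-1`
      seqDU (deviation_event c U) k).
    apply: (prob_sample_indep P Q) => //.
    apply: measurableD; first exact: measurable_deviation_event.
    by apply: bigsetU_measurable => i _; exact: measurable_deviation_event.
  rewrite /seqDU -(bigcup_mkord k A) -(bigcup_mkord k (deviation_event c U)).
  by apply/seteqP; split => w [Aw nAw]; split => // -[i ik Ai]; apply: nAw; exists i.
- by move=> k; exact: typical_ghost_prob.
rewrite lee_pmul2l//; apply: le_measure; rewrite ?inE.
- by apply: bigsetU_measurable => k _; exact: measurableI.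
- by apply: measurable_symmetrized_event => j; exact: measurable_funP.
rewrite -(bigcup_mkord _ (fun k => A k `&` E k)) => w [k /= kM [[/= A1 A2] [/= E1 E2]]].
move: A1 A2 E1 E2; rewrite !centered_sumE !sum_sqrE => A1 A2 E1 E2.
apply/andP; split.
  apply: lt_le_trans (le_bigmax _ (fun i : 'I_M => `|sign_sum n (pair_diff
    (fun j => Z j w) (fun j => Z (n + j)%N w) (f i)) (nseq n true)|) (Ordinal kM)).
  rewrite /=; set D := sign_sum _ _ _.
  have -> : D = \sum_(j < n) (f k (Z (first_sample j) w) - fine (\int[Q]_z (f k z)%:E)%E)
     - \sum_(j < n) (f k (Z (ghost_sample j) w) - fine (\int[Q]_z (f k z)%:E)%E).
    rewrite -sumrB; apply: eq_bigr => j _; rewrite nth_nseq ltn_ord mul1r /pair_diff.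
    by rewrite /first_sample /ghost_sample; ring.
  by apply: lt_le_trans (lerB_dist _ _); lra.
apply/implyP => ct; move: A2; rewrite ct /= => A2.
by rewrite /pair_sqr big_split/=; lra.
Qed.

End Ghost.

(** * Deviations over a class with finite entropy integral *)

Section DeviationBounds.
Context {R : realType} {d : nat}.
Local Notation Rd := (borel_rV R d).
Context {dO} {Omega : measurableType dO} (P : probability Omega R)
  (Q : probability Rd R) (Z : nat -> {RV P >-> Rd}).

Hypothesis Z_indep : mutually_independent P Z.
Hypothesis Z_distr : common_distribution P Z Q.

Variables (F : set (Rd -> R)) (xi : Rd -> R) (J mu : R).
Hypothesis F_meas : forall h, F h -> measurable_fun setT h.
Hypothesis F_env : positive_envelope F xi.
Hypothesis entropy : (entropy_integral F xi (1 / 8) <= J%:E)%E.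
Hypothesis J_gt0 : 0 < J.
Hypothesis mu_gt0 : 0 < mu.
Hypothesis xi_sqr : (\int[Q]_z (xi z ^+ 2)%:E <= (mu ^+ 2)%:E)%E.

Variables (f : nat -> Rd -> R).
Hypothesis fF : forall k, F (f k).
Variables (n M : nat).

Let xi_meas : measurable_fun setT xi. Proof. by have [] := F_env. Qed.
Let f_meas k : measurable_fun setT (f k). Proof. exact: F_meas. Qed.
Let f_le k z : `|f k z| <= xi z.
Proof. by have [_ _ H] := F_env; exact: H. Qed.

Let eta_hat_gt0 : 0 < eta_hat J.
Proof. by rewrite !mulr_gt0 ?sqrtr_gt0 ?addr_gt0 ?divr_gt0. Qed.

Let N := n.+1.
Let y w (j : nat) : Rd := Z j w.
Let y' w (j : nat) : Rd := Z (N + j)%N w.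

Let chaining w : rademacher N (max_sign_sum N
    (fun i : 'I_M => pair_diff (y w) (y' w) (f i)))
  <= eta_hat J / 4 * Num.sqrt (2 * pair_sqr N (y w) (y' w) xi).
Proof.
apply: le_trans (@rademacher_entropy R d n (y w) (y' w) F xi J M (fun i => f i)
  _ entropy F_meas F_env _) _ => //; first by exists (f 0%N).
by rewrite ler_wpM2r ?sqrtr_ge0// /eta_hat; lra.
Qed.

Let deviations c U := \big[setU/set0]_(k < M)
  (sample P Z N (fun i => i) @^-1` deviation_event Q N f xi mu c U k).

Let sN_gt0 : 0 < Num.sqrt N%:R :> R. Proof. by rewrite sqrtr_gt0 ltr0n. Qed.

Let sN_sqr : Num.sqrt N%:R ^+ 2 = N%:R :> R. Proof. by rewrite sqr_sqrtr. Qed.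

(** Deviations are counted in units of [mu * Num.sqrt N%:R]. At least four units give
    [16 * N * mu ^ 2 <= U ^ 2], the condition for a typical ghost sample. *)
Let deviation_le c x phi : 4 <= x -> measurable_fun setT phi ->
  (forall w, rademacher N (fun s => (symmetrized_event N M f xi c
      (x * mu * Num.sqrt N%:R / 2) (10 * N%:R * mu ^+ 2) (y w) (y' w) s)%:R) <= phi w) ->
  (P (deviations c (x * mu * Num.sqrt N%:R)) <= 2%:E * \int[P]_w (phi w)%:E)%E.
Proof.
move=> x4 mphi H; have x0 : 0 < x by lra.
apply: le_trans (prob_deviation_le P Q Z Z_indep Z_distr N M f xi f_meas xi_meas
  mu f_le xi_sqr c _ _ mu_gt0 _ _) _ => //.
- by rewrite !mulr_gt0.
- have -> : (x * mu * Num.sqrt N%:R) ^+ 2 = x ^+ 2 * (N%:R * mu ^+ 2).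
    by rewrite !exprMn sN_sqr; ring.
  rewrite -mulrA ler_wpM2r ?mulr_ge0 ?sqr_ge0 ?(ltW mu_gt0)//.
  have : 4 * 4 <= x * x by rewrite ler_pM.
  by rewrite expr2; lra.
- by rewrite lee_pmul2l//; apply: (prob_symmetrized_event_le P Q Z).
Qed.

(** Conditionally on the points, Markov's inequality divides the chaining bound by half the
    deviation. Averaging over the points contributes [2 * mu * Num.sqrt N%:R], so the quotient is
    [eta_hat J / x]; the factor 2 is the cost of the ghost sample. *)
Lemma prob_deviations_le_inv x : 4 <= x ->
  (P (deviations false (x * mu * Num.sqrt N%:R)) <= (2 * eta_hat J / x)%:E)%E.
Proof.
move=> x4; have x0 : 0 < x by lra.
set a := 2 * mu * Num.sqrt N%:R.
have a0 : 0 < a by rewrite !mulr_gt0.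
have a2 : a ^+ 2 = 4 * N%:R * mu ^+ 2 by rewrite !exprMn sN_sqr; ring.
(* AM-GM: [sqrt q <= (q / a + a) / 2], with [a ^ 2] the mean of [q] *)
pose phi w := eta_hat J / (2 * x * mu * Num.sqrt N%:R) *
  ((2 * pair_sqr N (y w) (y' w) xi) / a + a) / 2.
have q0 w : 0 <= 2 * pair_sqr N (y w) (y' w) xi.
  by rewrite mulr_ge0 ?pair_sqr_ge0.
have mps : measurable_fun setT (fun w => pair_sqr N (y w) (y' w) xi).
  by apply: measurable_pair_sqr => // j; exact: measurable_funP.
have c0 : 0 < eta_hat J / (2 * x * mu * Num.sqrt N%:R).
  by rewrite divr_gt0// !mulr_gt0.
have mphi : measurable_fun setT phi.
  apply: measurable_funM => //; apply: measurable_funM => //.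
  apply: measurable_funD => //; apply: measurable_funM => //.
  exact: measurable_funM.
apply: le_trans (deviation_le false x phi x4 mphi _) _.
  move=> w; have u0 : 0 < x * mu * Num.sqrt N%:R / 2 by rewrite divr_gt0 ?mulr_gt0.
  apply: le_trans (_ : rademacher N (fun s => (x * mu * Num.sqrt N%:R / 2)^-1 *
    max_sign_sum N (fun i : 'I_M => pair_diff (y w) (y' w) (f i)) s) <= _).
    apply: le_rademacher => s _; rewrite /symmetrized_event andbT.
    set m := max_sign_sum _ _ _; have m0 : 0 <= m by exact: max_sign_sum_ge0.
    have [/ltW um|_] := ltP _ m; first by rewrite mulrC ler_pdivlMr// mul1r.
    by rewrite mulr_ge0// invr_ge0 ltW.
  rewrite rademacherZ; apply: le_trans (ler_wpM2l _ (chaining w)) _.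
    by rewrite invr_ge0 ltW.
  have -> : phi w = (x * mu * Num.sqrt N%:R / 2)^-1 * (eta_hat J / 4 *
      ((2 * pair_sqr N (y w) (y' w) xi / a + a) / 2)).
    by rewrite /phi; field; rewrite !gt_eqF.
  rewrite ler_wpM2l ?invr_ge0 ?(ltW u0)// ler_wpM2l ?divr_ge0 ?(ltW eta_hat_gt0)//.
  set q := 2 * pair_sqr N (y w) (y' w) xi.
  have sq : Num.sqrt q ^+ 2 = q by rewrite sqr_sqrtr// q0.
  have -> : (q / a + a) / 2 = (Num.sqrt q ^+ 2 + a ^+ 2) / (2 * a).
    by rewrite sq; field; rewrite gt_eqF.
  rewrite ler_pdivlMr ?mulr_gt0//.
  have := sqr_ge0 (Num.sqrt q - a); rewrite sqrrB; lra.
have Eps : (\int[P]_w (pair_sqr N (y w) (y' w) xi)%:E <= (2 * N%:R * mu ^+ 2)%:E)%E.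
  under eq_integral do rewrite -sumEFin.
  have mxi2 k : measurable_fun setT (fun w => (xi (Z k w) ^+ 2)%:E).
    by apply/measurable_EFinP; apply: measurable_funX; exact: measurableT_comp.
  have xi2_ge0 k w : (0 <= (xi (Z k w) ^+ 2)%:E)%E by rewrite lee_fin sqr_ge0.
  have Exi k : (\int[P]_w (xi (Z k w) ^+ 2)%:E <= (mu ^+ 2)%:E)%E.
    rewrite (@ge0_integral_Z _ _ _ _ _ P Q Z Z_distr (fun z => (xi z ^+ 2)%:E))//.
      by apply/measurable_EFinP; exact: measurable_funX.
    by move=> z; rewrite lee_fin sqr_ge0.
  rewrite ge0_integral_sum//; last 2 first.
  - move=> j; apply/measurable_EFinP; apply: measurable_funD;
      exact/measurable_EFinP/mxi2.
  - by move=> j w _; rewrite lee_fin addr_ge0 ?sqr_ge0.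
  have -> : 2 * N%:R * mu ^+ 2 = (mu ^+ 2 + mu ^+ 2) *+ N.
    by rewrite -[RHS]mulr_natr; ring.
  rewrite -[N in leRHS]card_ord -sumr_const -sumEFin.
  apply: lee_sum => j _.
  under eq_integral do rewrite EFinD.
  rewrite ge0_integralD//; first exact: (leeD (Exi j) (Exi (N + j)%N)).
  - by move=> w _; exact: xi2_ge0.
  - exact: mxi2.
  - by move=> w _; exact: xi2_ge0.
  - exact: mxi2.
have -> : (2 * eta_hat J / x)%:E = (2%:E * ((eta_hat J / (2 * x * mu * Num.sqrt N%:R))
    * ((2 * (2 * N%:R * mu ^+ 2) / a + a) / 2))%:E)%E.
  rewrite -EFinM; congr EFin; rewrite /a.
  have -> : N%:R = Num.sqrt N%:R ^+ 2 :> R by rewrite sN_sqr.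
  by rewrite sqrtr_sqr ger0_norm ?ltW//; field; rewrite !gt_eqF.
rewrite lee_pmul2l//.
pose ps w : \bar R := (pair_sqr N (y w) (y' w) xi)%:E.
have ps0 w : (0 <= ps w)%E by rewrite lee_fin pair_sqr_ge0.
have mpsE : measurable_fun setT ps by exact/measurable_EFinP.
have a1 : 0 <= a^-1 by rewrite invr_ge0 ltW.
have a2' : 0 <= a / 2 by rewrite divr_ge0// ltW.
under eq_integral => w _.
  rewrite (_ : (phi w)%:E = (eta_hat J / (2 * x * mu * Num.sqrt N%:R))%:E
      * (a^-1%:E * ps w + (a / 2)%:E))%E; last first.
    by rewrite /ps -EFinM; congr EFin; rewrite /phi; field; rewrite !gt_eqF.
  over.
rewrite ge0_integralZl_EFin ?(ltW c0)//; last 2 first.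
- by move=> w _; rewrite adde_ge0 ?mule_ge0.
- by apply: emeasurable_funD => //; exact: measurable_funeM.
rewrite [leRHS]EFinM lee_pmul2l ?lte_fin//.
rewrite ge0_integralD//; last 2 first.
- by move=> w _; rewrite mule_ge0.
- exact: measurable_funeM.
rewrite ge0_integralZl_EFin//.
have -> : (\int[P]_w (a / 2)%:E = (a / 2)%:E)%E.
  by rewrite -[RHS](expectation_cst P (a / 2)) unlock.
have -> : (2 * (2 * N%:R * mu ^+ 2) / a + a) / 2 = a^-1 * (2 * N%:R * mu ^+ 2) + a / 2.
  by field; rewrite gt_eqF.
by rewrite [leRHS]EFinD leeD// [leRHS]EFinM lee_wpmul2l.
Qed.

(** When the squared envelope is at most [10 * N * mu ^ 2], both the conditional mean and the
    bounded differences are controlled by deterministic quantities, so McDiarmid's inequality holds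
    uniformly in the points; otherwise the event is empty. *)
Lemma prob_deviations_le_exp x : 4 * eta_hat J <= x -> 4 <= x ->
  (P (deviations true (x * mu * Num.sqrt N%:R)) <= (2 * expR (- (x ^+ 2 / 1000)))%:E)%E.
Proof.
move=> xe x4; have x0 : 0 < x by lra.
have NR0 : (0 : R) < N%:R by rewrite ltr0n.
apply: le_trans (deviation_le true x (fun=> expR (- (x ^+ 2 / 1000))) x4 _ _) _ => //; last first.
  rewrite [X in (_ * X <= _)%E](_ : _ = (expR (- (x ^+ 2 / 1000)))%:E).
    by rewrite -EFinM.
  by rewrite -[RHS](expectation_cst P) unlock.
move=> w; rewrite /symmetrized_event.
have [psV|psV] := leP (pair_sqr N (y w) (y' w) xi) (10 * N%:R * mu ^+ 2); last first.
  apply: le_trans (_ : rademacher N (fun=> 0) <= _); last by rewrite rademacher_cst expR_ge0.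
  by apply: le_rademacher => s _; rewrite andbF.
set u := x * mu * Num.sqrt N%:R / 2.
(* Here 9/2 bounds the square root of 20 = 2 * 10. Since [eta_hat J <= x / 4], the gap [u - e] is at
   least 1/2 - 9/32 = 7/32 times [x] units. With 2B = 40 units squared the exponent is 49/40960
   times [x ^ 2], more than [x ^ 2 / 1000]. *)
set e := 9 / 8 * eta_hat J * (mu * Num.sqrt N%:R).
set B := 20 * N%:R * mu ^+ 2.
have B0 : 0 < B by rewrite !mulr_gt0 ?exprn_gt0.
have msN : 0 < mu * Num.sqrt N%:R by rewrite mulr_gt0.
have eu : 7 / 32 * (x * (mu * Num.sqrt N%:R)) <= u - e.
  have : eta_hat J * (mu * Num.sqrt N%:R) <= x / 4 * (mu * Num.sqrt N%:R).
    by rewrite ler_wpM2r ?(ltW msN)//; lra.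
  by rewrite /u /e; lra.
have eu0 : 0 <= 7 / 32 * (x * (mu * Num.sqrt N%:R)) by rewrite !mulr_ge0 ?ltW// divr_gt0.
apply: le_trans (_ : rademacher N (fun s => (u <= max_sign_sum N
    (fun i : 'I_M => pair_diff (y w) (y' w) (f i)) s)%R%:R) <= _).
  by apply: le_rademacher => s _; rewrite andbT; case: ltP => // /ltW ->.
apply: le_trans (@rademacher_max_sign_sum_tail R N M _
  (fun j => xi (y w j) + xi (y' w j)) B e u _ _ B0 _ _ _) _.
- by move=> j; rewrite addr_ge0// (le_trans _ (f_le 0%N _)).
- move=> i j _; apply: le_trans (ler_normB _ _) _; exact: lerD.
- apply: le_trans (_ : 2 * pair_sqr N (y w) (y' w) xi <= _); last by rewrite /B; lra.
  rewrite mulr_sumr; apply: ler_sum => j _.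
  by have := sqr_ge0 (xi (y w j) - xi (y' w j)); rewrite sqrrB sqrrD; lra.
- apply: le_trans (chaining w) _.
  have -> : e = eta_hat J / 4 * (9 / 2 * (mu * Num.sqrt N%:R)) by rewrite /e; field.
  rewrite ler_wpM2l ?divr_ge0 ?(ltW eta_hat_gt0)//.
  have p0 : 0 <= 9 / 2 * (mu * Num.sqrt N%:R) by rewrite mulr_ge0 ?(ltW msN).
  rewrite -ler_sqr ?nnegrE ?sqrtr_ge0// sqr_sqrtr ?mulr_ge0 ?pair_sqr_ge0//.
  by rewrite !exprMn sN_sqr; nra.
- by rewrite -subr_ge0 (le_trans eu0).
rewrite ler_expR lerN2 ler_pdivlMr ?mulr_gt0//.
apply: le_trans (_ : (7 / 32 * (x * (mu * Num.sqrt N%:R))) ^+ 2 <= _); last first.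
  by rewrite lerXn2r ?nnegrE// (le_trans eu0).
have -> : (7 / 32 * (x * (mu * Num.sqrt N%:R))) ^+ 2 = 49 / 1024 * (x ^+ 2 * (N%:R * mu ^+ 2)).
  by rewrite !exprMn sN_sqr; field.
rewrite /B; have : 0 <= x ^+ 2 * (N%:R * mu ^+ 2).
  by rewrite mulr_ge0 ?sqr_ge0// mulr_ge0 ?sqr_ge0// ltW.
lra.
Qed.

End DeviationBounds.

(** * From the estimator in a shell to a deviation over a sequence *)

Section Shells.
Context {R : realType} {m d : nat}.
Local Notation Rd := (borel_rV R d).
Context {dO} {Omega : measurableType dO} (P : probability Omega R)
  (Q : probability Rd R) (Z : nat -> {RV P >-> Rd}).
Variables (Theta : set 'rV[R]_m) (G : 'rV[R]_m -> Rd -> R).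
Variables (theta_star : 'rV[R]_m) (M1 : R).

Hypothesis Z_indep : mutually_independent P Z.
Hypothesis Z_distr : common_distribution P Z Q.
Hypothesis G_integrable : forall theta, Theta theta ->
  Q.-integrable setT (EFin \o G theta).
Hypothesis theta_star_in : Theta theta_star.
Hypothesis M1_gt0 : 0 < M1.
Hypothesis risk_quadratic : forall theta, Theta theta ->
  M1 * enorm (theta - theta_star) ^+ 2
  <= risk G P Z theta - risk G P Z theta_star.
Hypothesis G_separable : separability G Theta theta_star P Z Q.

Lemma enormB_eq0 (x : 'rV[R]_m) : enorm (x - x) = 0.
Proof.
by rewrite /enorm big1 ?sqrtr0// => i _; rewrite !mxE subrr expr0n.
Qed.

Let g theta z := G theta z - G theta_star z.

Lemma G_measurable theta : Theta theta -> measurable_fun setT (G theta).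
Proof. by move=> /G_integrable /integrableP[/measurable_EFinP]. Qed.

Lemma local_class_measurable delta h :
  local_class G Theta theta_star delta h -> measurable_fun setT h.
Proof. by move=> [theta [Tt _] <-]; apply: measurable_funB; exact: G_measurable. Qed.

Let G_mean theta : R := fine (\int[Q]_z (G theta z)%:E)%E.

Let G_meanE theta : Theta theta -> (\int[Q]_z (G theta z)%:E = (G_mean theta)%:E)%E.
Proof. by move=> Tt; rewrite fineK// integrable_fin_num//; exact: G_integrable. Qed.

Let riskE theta : Theta theta -> risk G P Z theta = G_mean theta.
Proof.
by move=> Tt; rewrite /risk unlock (integral_Z P Q Z Z_distr _ 0%N (G_integrable _ Tt)).
Qed.

Let g_mean theta : Theta theta ->
  fine (\int[Q]_z (g theta z)%:E)%E = G_mean theta - G_mean theta_star.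
Proof.
move=> Tt; under eq_integral do rewrite EFinB.
by rewrite integralB_EFin ?G_meanE//; exact: G_integrable.
Qed.

Let G_mean_dist theta theta' : Theta theta -> Theta theta' ->
  (`|G_mean theta - G_mean theta'|%:E
   <= 'E_P[fun w => `|G theta (Z 0%N w) - G theta' (Z 0%N w)|%R])%E.
Proof.
move=> Tt Tt'; rewrite unlock.
have mD : measurable_fun setT (fun z => G theta z - G theta' z).
  by apply: measurable_funB; exact: G_measurable.
rewrite (@ge0_integral_Z _ _ _ _ _ P Q Z Z_distr
  (fun z => `|G theta z - G theta' z|%:E)); last 2 first.
- by apply/measurable_EFinP; exact: measurableT_comp.
- by move=> z; rewrite lee_fin.
apply: le_trans (le_abse_integral Q measurableT (f := fun z => (G theta z - G theta' z)%:E) _).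
  under eq_integral do rewrite EFinB.
  rewrite integralB_EFin ?G_meanE//; exact: G_integrable.
exact/measurable_EFinP.
Qed.

Variable n : nat.
Hypothesis n_gt0 : (0 < n)%N.
Let W := sample P Z n (fun i => i).

(** A strict deviation leaves a gap between [U] and the modulus of the centered sum. Separability
    gives an approximant in the countable set whose centered sum differs by at most half the gap.
    The exceptional set [N0] depends only on the sample, not on [theta] or [U]. *)
Lemma separable_deviation delta : 0 < delta ->
  exists (theta_ : nat -> 'rV[R]_m) (N0 : set Omega),
  [/\ measurable N0, P N0 = 0%E,
      forall k, localized Theta theta_star delta (theta_ k) &
      forall w theta U, ~ N0 w -> localized Theta theta_star delta theta ->
        U < `|centered_sum Q n (g theta) (W w)| ->
        exists k, U < `|centered_sum Q n (g (theta_ k)) (W w)|].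
Proof.
move=> delta0.
have [C [N [/countable_injP[i iI] CD /(_ n n_gt0)[B [mB B0 NB]] inf0]]] := G_separable delta delta0.
pose theta_ k := xget theta_star [set vt | C vt /\ i vt = k].
have ts : localized Theta theta_star delta theta_star.
  by split=> //; rewrite enormB_eq0 ltW.
have theta_iK vt : C vt -> theta_ (i vt) = vt.
  move=> Cvt; rewrite /theta_; case: xgetP => [x -> [Cx ix]|/(_ vt)]; last by case.
  by apply: iI; rewrite ?inE.
exists theta_, (W @^-1` B); split.
- exact: measurable_sample_preimage.
- by rewrite /W (prob_sample P Q Z Z_indep Z_distr)//; exact: val_inj.
- by move=> k; rewrite /theta_; case: xgetP => [x -> [Cx _]|//]; exact: CD.
move=> w theta U nB loc Utheta; have [Tt _] := loc.
set S := centered_sum Q n (g theta) (W w).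
have n0 : (0 : R) < n%:R by rewrite ltr0n.
(* Each of the n summands may move by [e], hence the division by 2n. *)
pose e := (`|S| - U) / (2 * n%:R).
have e0 : 0 < e by rewrite divr_gt0 ?subr_gt0 ?mulr_gt0.
have := inf0 theta n (W w) loc n_gt0 (fun Nw => nB (NB _ Nw)).
move=> infe; have : (ereal_inf [set ('E_P[fun w => `|G theta (Z 0%N w) - G vt (Z 0%N w)|%R]
   + (\big[Num.max/0]_(j < n) `|G theta (tnth (W w) j) - G vt (tnth (W w) j)|)%R%:E)%E
     | vt in C] < e%:E)%E by rewrite infe lte_fin.
move=> /ereal_inf_lt[_ [vt Cvt <-]]; set b := (\big[Num.max/0]_(_ < n) _)%R => Eb.
have [Tvt _] := CD _ Cvt.
have b0 : 0 <= b by exact: bigmax_ge_id.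
have Emean : `|G_mean theta - G_mean vt| + b < e.
  rewrite -lte_fin EFinD; apply: le_lt_trans Eb; rewrite leeD2r//.
  exact: G_mean_dist.
exists (i vt); rewrite theta_iK//.
have dist : `|S - centered_sum Q n (g vt) (W w)| <= n%:R * e.
  rewrite /S /centered_sum -sumrB; apply: le_trans (ler_norm_sum _ _ _) _.
  rewrite -[n in leRHS]card_ord mulr_natl -sumr_const; apply: ler_sum => j _.
  rewrite !g_mean//.
  have -> : g theta (tnth (W w) j) - (G_mean theta - G_mean theta_star)
     - (g vt (tnth (W w) j) - (G_mean vt - G_mean theta_star))
     = (G theta (tnth (W w) j) - G vt (tnth (W w) j)) - (G_mean theta - G_mean vt).
    by rewrite /g; ring.
  apply: le_trans (ler_normB _ _) _; rewrite addrC; apply: le_trans (ltW Emean).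
  by rewrite lerD2l (le_bigmax _ (fun j => `|G theta (tnth (W w) j) - G vt (tnth (W w) j)|)).
have en : n%:R * e = (`|S| - U) / 2 by rewrite /e; field; rewrite gt_eqF.
have := lerB_dist S (S - centered_sum Q n (g vt) (W w)); rewrite subKr.
by move: dist Utheta; rewrite en -/S; lra.
Qed.

Variable theta_hat : {RV P >-> borel_rV R m}.
Hypothesis theta_hat_min : M_estimator G Theta Z n theta_hat.

(** Minimality makes the empirical sum of [g (theta_hat w)] nonpositive, while its mean is at least
    [M1] times the squared distance. Centering therefore pushes the sum below minus the left-hand
    side. *)
Lemma deviation_at_estimator w :
  n%:R * (M1 * enorm (theta_hat w - theta_star) ^+ 2)
  <= `|centered_sum Q n (g (theta_hat w)) (W w)|.
Proof.
have [Tw /(_ _ theta_star_in)] := theta_hat_min w.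
rewrite /empirical_risk ler_pM2l ?invr_gt0 ?ltr0n// => emp.
have := risk_quadratic _ Tw; rewrite !riskE// => quad.
rewrite -normrN; apply: le_trans (ler_norm _).
rewrite /centered_sum -sumrN.
under eq_bigr do rewrite tnth_mktuple g_mean// opprB.
rewrite sumrB sumr_const card_ord -[X in _ <= X - _]mulr_natl.
apply: le_trans (_ : n%:R * (G_mean (theta_hat w) - G_mean theta_star) <= _).
  by rewrite ler_wpM2l.
rewrite lerDl oppr_ge0 /g sumrB; lra.
Qed.

Lemma measurable_enorm_theta_hat :
  measurable_fun setT (fun w => enorm (theta_hat w - theta_star)).
Proof.
have mcoord i : measurable_fun setT (fun w => theta_hat w 0 i).
  apply: (measurableT_comp (f := fun x : borel_rV R m => (x : 'rV[R]_m) 0 i)) => //.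
  apply: (measurability _ (RGenOpens.measurableE R)) => _ [_ [a [b ->] <-]].
  rewrite setTI; apply: sub_sigma_algebra.
  apply: open_comp; last exact: interval_open.
  by move=> x _; exact: coord_continuous.
rewrite (_ : (fun w => _) = fun w => (\sum_(i < m)
    (theta_hat w 0 i - theta_star 0 i) ^+ 2) `^ 2^-1).
  apply: (measurableT_comp (measurable_powR _)).
  apply: measurable_sum => i; apply: measurable_funX.
  exact: measurable_funB.
apply/funext => w; rewrite powR12_sqrt; last by apply: sumr_ge0 => i _; exact: sqr_ge0.
by rewrite /enorm; congr Num.sqrt; apply: eq_bigr => i _; rewrite !mxE.
Qed.

Definition shell (rho delta : R) : set Omega :=
  [set w | rho < enorm (theta_hat w - theta_star) <= delta].

Lemma measurable_shell rho delta : measurable (shell rho delta).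
Proof.
have -> : shell rho delta = [set w | rho < enorm (theta_hat w - theta_star)]
    `&` [set w | enorm (theta_hat w - theta_star) <= delta].
  by apply/seteqP; split => w /=; [move=> /andP[] | move=> [? ?]; apply/andP].
have mt := measurable_enorm_theta_hat.
by apply: measurableI; [exact: measurable_gt_set|exact: measurable_le_set].
Qed.

(** Off a null set, an estimator in the shell forces a deviation at some index of the sequence.
    Because [p] does not depend on [M], continuity from below carries the bound from finite unions
    to the countable one. *)
Lemma prob_shell_le c rho delta xi mu (p : R) : 0 <= rho -> 0 < delta ->
  measurable_fun setT xi ->
  (forall f M, (forall k, local_class G Theta theta_star delta (f k)) ->
    (P (\big[setU/set0]_(k < M)
       (W @^-1` deviation_event Q n f xi mu c (n%:R * (M1 * rho ^+ 2))%R k)) <= p%:E)%E) ->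
  (P (shell rho delta `&`
      [set w | (c ==> (sum_sqr n xi (W w) <= 2 * n%:R * mu ^+ 2))%R]) <= p%:E)%E.
Proof.
move=> rho0 delta0 mxi H.
have [theta_ [N0 [mN0 PN0 theta_loc dev]]] := separable_deviation delta delta0.
pose f k := g (theta_ k).
have fF k : local_class G Theta theta_star delta (f k) by exists (theta_ k).
pose A k := W @^-1` deviation_event Q n f xi mu c (n%:R * (M1 * rho ^+ 2)) k.
have mA k : measurable (A k).
  apply: measurable_sample_preimage; apply: measurable_deviation_event => //.
  move=> j; exact: (@local_class_measurable delta).
pose D M := \big[setU/set0]_(k < M) A k.
have mD M : measurable (D M) by exact: bigsetU_measurable.
have PA : (P (\bigcup_k A k) <= p%:E)%E.
  have ndD : nondecreasing_seq D by move=> a b ab; apply/subsetPset; exact: subset_bigsetU.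
  have DA : \bigcup_k D k = \bigcup_k A k.
    apply/seteqP; split => w [k _ kw]; first exact: bigsetU_bigcup kw.
    by exists k.+1 => //; exact: (@bigsetU_sup _ k k.+1 A (ltnSn k)).
  rewrite -DA; have mU : measurable (\bigcup_k D k) by exact: bigcupT_measurable.
  have cvP := nondecreasing_cvg_mu (mu := P) mD mU ndD.
  have <- : limn (fun k => P (D k)) = P (\bigcup_k D k) by exact: cvg_lim cvP.
  apply: lime_le; first by apply/cvg_ex; eexists; exact: cvP.
  by apply: nearW => M; exact: H.
apply: le_trans (_ : P (N0 `|` \bigcup_k A k) <= _)%E; last first.
  have PNA : (P N0 + P (\bigcup_k A k) <= p%:E)%E by rewrite PN0 add0e.
  exact: le_trans (measureU2 _ mN0 (bigcupT_measurable _ mA)) PNA.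
apply: le_measure; rewrite ?inE.
- apply: measurableI; first exact: measurable_shell.
  case: c {H A mA D mD PA} => /=.
    apply: measurable_le_set.
    exact: (measurableT_comp (measurable_sum_sqr n xi mxi) (measurable_sample _ _ _ _)).
  by rewrite (_ : mkset _ = setT)//; apply/seteqP; split.
- by apply: measurableU => //; exact: bigcupT_measurable.
move=> w [/= /andP[rw wd] cw]; have [N0w|nN0] := pselect (N0 w); [by left|right].
have [Tw _] := theta_hat_min w.
have [|k Uk] := dev w (theta_hat w) (n%:R * (M1 * rho ^+ 2)) nN0 (conj Tw wd).
  apply: lt_le_trans (deviation_at_estimator w).
  rewrite ltr_pM2l ?ltr0n// ltr_pM2l//.
  by rewrite ltr_pXn2r ?nnegrE// (le_trans rho0)// ltW.
by exists k => //; split. 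
Qed.

End Shells.

(** * Geometric series and powers *)

Section GeometricSeries.
Context {R : realType}.

Lemma nneseries_le_geometric (u : nat -> \bar R) (c : R) :
  (forall j, 0 <= u j)%E -> (forall j, u j <= (c / 2 ^+ j)%:E)%E ->
  (\sum_(j <oo) u j <= (2 * c)%:E)%E.
Proof.
move=> u0 uc; apply: lime_le; first exact: is_cvg_nneseries.
apply: nearW => n; rewrite big_mkord.
have c0 : 0 <= c.
  by have := le_trans (u0 0%N) (uc 0%N); rewrite lee_fin expr0 divr1.
apply: le_trans (_ : (2 * c - 2 * c / 2 ^+ n)%:E <= _)%E; last first.
  by rewrite lee_fin lerBlDr lerDl divr_ge0 ?mulr_ge0 ?exprn_ge0.
elim: n => [|n IH]; first by rewrite big_ord0 expr0 divr1 subrr.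
rewrite big_ord_recr/=; apply: le_trans (leeD IH (uc n)) _.
rewrite -EFinD lee_fin exprS; have : 0 < 2 ^+ n :> R by rewrite exprn_gt0.
by move=> n0; rewrite le_eqVlt; apply/orP; left; apply/eqP; field; rewrite gt_eqF.
Qed.

Lemma powR_add (x r s : R) : 0 < x -> x `^ (r + s) = x `^ r * x `^ s.
Proof. by move=> x0; rewrite powRD//; apply/implyP => _; rewrite gt_eqF. Qed.

End GeometricSeries.

(** * Numerical inequalities for the constants *)

Section Numerics.
Context {R : realType}.
Implicit Types (x y s t k beta eps : R).

Lemma g_rate_ge0 t : 0 < t -> 0 <= g_rate t.
Proof.
by move=> t0; rewrite divr_ge0 ?sqr_ge0// !mulr_ge0// addr_ge0 ?mulr_ge0// ltW.
Qed.

(** The value 1/40 is the limit of [g_rate] at infinity. *)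
Lemma g_rate_le t : 0 < t -> g_rate t <= 1 / 40.
Proof.
move=> t0; rewrite ler_pdivrMr; last by rewrite !mulr_gt0 ?addr_gt0 ?mulr_gt0.
have := sqr_ge0 t; nra.
Qed.

Lemma eta_hat_ge (M : R) : 0 < M -> 125 / 2 <= eta_hat M.
Proof.
move=> M0; have s2 : 14 / 10 <= Num.sqrt 2 :> R.
  by rewrite -ler_sqr ?nnegrE ?sqrtr_ge0// sqr_sqrtr//; lra.
apply: le_trans (_ : 64 * (14 / 10) * (7 / 10) <= _); first by lra.
by rewrite /eta_hat ler_pM ?mulr_ge0// ?ler_pM2l//; lra.
Qed.

Lemma expR_ge_sqr x : 0 <= x -> x ^+ 2 / 2 <= expR x.
Proof.
by move=> x0; have := @expR_ge1Dxn R x 1 x0; rewrite (_ : 2`!%:R = 2)//; lra.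
Qed.

(** From s >= 2X and X >= 126 the exponent s^2/1000 is at least 0.504 X. The part X/40 dominates y
    g, and the remaining 0.4 X pays for the prefactor, since exp(0.4 X) >= 0.08 X^2 >= 8 X. *)
Lemma exp_sqr_le_inv_exp X y s D g : 126 <= X -> 0 < y -> y <= X -> 2 * X <= s ->
  0 < D -> D <= 2 -> 0 <= g -> g <= 1 / 40 ->
  4 * expR (- (s ^+ 2 / 1000)) <= expR (- (y * g)) / (D * y).
Proof.
move=> X126 y0 yX Xs D0 D2 g0 g1; have X0 : 0 < X by lra.
have Dy : D * y <= 2 * X by rewrite ler_pM// ltW.
apply: le_trans (_ : expR (- (X / 40)) / (2 * X) <= _); last first.
  rewrite ler_pM ?expR_ge0 ?invr_ge0 ?mulr_ge0 ?(ltW X0)//.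
    have : y * g <= X * (1 / 40) by rewrite ler_pM// ltW.
    by rewrite ler_expR; lra.
  by rewrite lef_pV2 ?posrE ?mulr_gt0.
apply: le_trans (_ : 4 * expR (- (X / 40) - 4 / 10 * X) <= _).
  rewrite ler_pM2l// ler_expR.
  have : (2 * X) * (2 * X) <= s ^+ 2 by rewrite expr2 ler_pM ?mulr_ge0 ?(ltW X0).
  have : 126 * X <= X * X by rewrite ler_wpM2r ?(ltW X0).
  lra.
rewrite expRB mulrCA ler_wpM2l ?expR_ge0//.
have Xn0 : X != 0 by rewrite gt_eqF.
have -> : (2 * X)^-1 = 4 * (8 * X)^-1 by field.
rewrite ler_pM2l// lef_pV2 ?posrE ?expR_gt0 ?mulr_gt0//.
have := @expR_ge_sqr (4 / 10 * X); rewrite mulr_ge0 ?(ltW X0)// => /(_ isT).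
have : 126 * X <= X * X by exact: (ler_wpM2r (ltW X0) X126).
by rewrite exprMn expr2; lra.
Qed.

(** The minimum is bounded by 2 if K >= 0 and by [eps] if K < 0. In both cases the exponents then
    agree exactly; the positive part of K on the right records the case. *)
Lemma powR_min_le eps beta (K : int) : 0 < eps -> beta <= 1 ->
  eps <= 2 `^ (K%:~R + 1) ->
  eps `^ (3 / 2 - beta) * Num.sqrt (Num.min eps 2)
  <= 2 `^ (2 - beta) * 2 `^ (K%:~R * (2 - beta) - Num.max K%:~R 0 / 2).
Proof.
move=> e0 b1 eK; set k : R := K%:~R in eK *.
have min0 : 0 <= Num.min eps 2 by rewrite le_min (ltW e0) /= ler0n.
rewrite -powR12_sqrt// -powR_add//.
have pw (x y r : R) : 0 <= r -> 0 <= x -> x <= y -> x `^ r <= y `^ r.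
  by move=> r0 x0 xy; apply: ge0_ler_powR => //; rewrite nnegrE// (le_trans x0).
have e3 : eps `^ (3 / 2 - beta) <= 2 `^ ((k + 1) * (3 / 2 - beta)).
  by rewrite powRrM; apply: pw; rewrite ?(ltW e0)//; lra.
have [k0|k0] := leP 0 k.
  apply: le_trans (_ : 2 `^ ((k + 1) * (3 / 2 - beta)) * 2 `^ (2^-1) <= _).
    by rewrite ler_pM ?powR_ge0//; apply: pw => //; rewrite ge_min lexx orbT.
  rewrite -powR_add// le_eqVlt; apply/orP; left; apply/eqP; congr (_ `^ _).
  by field.
have k1 : k + 1 <= 0.
  by move: k0; rewrite ltrz0 -lezD1 => k0; rewrite -[1]/(1%:~R) -intrD lerz0.
apply: le_trans (_ : 2 `^ ((k + 1) * (3 / 2 - beta)) * 2 `^ ((k + 1) / 2) <= _).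
  rewrite ler_pM ?powR_ge0// powRrM; apply: pw => //.
  by rewrite ge_min eK.
rewrite -powR_add// le_eqVlt; apply/orP; left; apply/eqP; congr (_ `^ _).
by field.
Qed.

Lemma K_itv eps : 0 < eps ->
  2 `^ (K_ eps)%:~R <= eps /\ eps <= 2 `^ ((K_ eps)%:~R + 1).
Proof.
move=> e0; have ln20 : 0 < ln 2 :> R by rewrite ln_gt0// ltr1n.
have eE : eps = 2 `^ (ln eps / ln 2).
  by rewrite /powR gt_eqF// divfK ?gt_eqF// lnK.
have /andP[K1 K2] := floor_itv (ln eps / ln 2); split.
  by rewrite [leRHS]eE ler_powR ?ler1n.
by rewrite [leLHS]eE ler_powR ?ler1n// -[1]/(1%:~R) -intrD ltW.
Qed.

End Numerics.

(** * Summation over the shells *)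

Section Tail.
Context {R : realType} {m d : nat}.
Local Notation Rd := (borel_rV R d).
Context {dO} {Omega : measurableType dO} (P : probability Omega R)
  (Q : probability Rd R) (Z : nat -> {RV P >-> Rd}).
Variables (Theta : set 'rV[R]_m) (G : 'rV[R]_m -> Rd -> R).
Variables (theta_star : 'rV[R]_m) (M1 beta Mlow Mup : R).
Variable xi_ : R -> Rd -> R.

Hypothesis Z_indep : mutually_independent P Z.
Hypothesis Z_distr : common_distribution P Z Q.
Hypothesis G_integrable : forall theta, Theta theta ->
  Q.-integrable setT (EFin \o G theta).
Hypothesis theta_star_in : Theta theta_star.
Hypothesis M1_gt0 : 0 < M1.
Hypothesis risk_quadratic : forall theta, Theta theta ->
  M1 * enorm (theta - theta_star) ^+ 2
  <= risk G P Z theta - risk G P Z theta_star.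
Hypothesis G_separable : separability G Theta theta_star P Z Q.
Hypothesis Theta_diam : 0 < diameter Theta.
Hypothesis diam_ge : forall theta, Theta theta ->
  enorm (theta - theta_star) <= diameter Theta.
Hypothesis beta_gt0 : 0 < beta.
Hypothesis beta_le1 : beta <= 1.
Hypothesis Mlow_gt0 : 0 < Mlow.
Hypothesis Mup_gt0 : 0 < Mup.
Hypothesis xi_envelope : forall delta, 0 < delta <= diameter Theta ->
  positive_envelope (local_class G Theta theta_star delta) (xi_ delta).
Hypothesis xi_norm : forall delta, 0 < delta <= diameter Theta ->
  (Lnorm Q 2%:E (EFin \o xi_ delta) <= (Mlow * delta `^ beta)%:E)%E.
Hypothesis entropy_bound : forall delta, 0 < delta <= diameter Theta ->
  (entropy_integral (local_class G Theta theta_star delta) (xi_ delta) (1 / 8)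
   <= Mup%:E)%E.

Variables (n : nat) (theta_hat : {RV P >-> borel_rV R m}).
Hypothesis n_gt0 : (0 < n)%N.
Hypothesis theta_hat_min : M_estimator G Theta Z n theta_hat.

Let rate : R := n%:R `^ (4 - 2 * beta)^-1.
Let W := sample P Z n (fun i => i).

Let rate_gt0 : 0 < rate. Proof. by rewrite powR_gt0// ltr0n. Qed.

Let b2_gt0 : 0 < 2 - beta.
Proof. by rewrite subr_gt0 (le_lt_trans beta_le1)// ltr1n. Qed.

(** The signal-to-noise ratio of the shell between [a / 2] and [a] in units of [rate^-1]: the risk
    growth [n * M1 * (a / 2 / rate) ^ 2] over [mu a * Num.sqrt n%:R]. The 4 is the square of the
    ratio of the radii. *)
Definition signal (a : R) : R := M1 / (4 * Mlow) * a `^ (2 - beta).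

(** A bound for the L2 norm of the envelope at radius [a / rate]; it still holds after truncation of
    the radius at the diameter. *)
Let mu (a : R) : R := Mlow * (a / rate) `^ beta.

(* The exponent 1/(4 - 2 beta) of the rate is the one for which this identity
   has no power of [n] left. *)
Let thresholdE a : 0 < a ->
  n%:R * (M1 * (a / 2 / rate) ^+ 2) = signal a * mu a * Num.sqrt n%:R.
Proof.
move=> a0; have r0 := rate_gt0.
have n0 : (0 : R) < n%:R by rewrite ltr0n.
rewrite /signal /mu powRM ?(ltW a0) ?invr_ge0 ?(ltW r0)//.
have -> : a `^ (2 - beta) = a ^+ 2 / a `^ beta.
  rewrite -powR_mulrn ?(ltW a0)// -powRB//.
  by apply/implyP => _; rewrite gt_eqF.
have -> : rate^-1 `^ beta = (rate `^ beta)^-1.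
  by rewrite -powR_inv1 ?(ltW r0)// -powRrM mulN1r powRN.
have sqE : Num.sqrt n%:R = n%:R * rate `^ beta / rate ^+ 2 :> R.
  rewrite -powR12_sqrt// -[X in X * _ / _](powRr1 (ltW n0)).
  rewrite -[rate ^+ 2]powR_mulrn ?(ltW r0)// /rate -!powRrM -powRN.
  rewrite -!powR_add//; congr (_ `^ _).
  by field; apply: lt0r_neq0; have := b2_gt0; lra.
rewrite sqE; field.
by rewrite !gt_eqF ?powR_gt0.
Qed.

Let delta (a : R) : R := Num.min (a / rate) (diameter Theta).

Let delta_in a : 0 < a -> 0 < delta a <= diameter Theta.
Proof.
by move=> a0; rewrite /delta lt_min divr_gt0//= Theta_diam ge_min lexx orbT.
Qed.

Let xi_sqr a : 0 < a ->
  (\int[Q]_z (xi_ (delta a) z ^+ 2)%:E <= (mu a ^+ 2)%:E)%E.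
Proof.
move=> a0; have := xi_norm _ (delta_in a a0) => xn.
have mua : Mlow * delta a `^ beta <= mu a.
  rewrite ler_wpM2l ?(ltW Mlow_gt0)// ge0_ler_powR ?(ltW beta_gt0)//.
  - by rewrite nnegrE; case/andP: (delta_in a a0) => /ltW.
  - by rewrite nnegrE divr_ge0// ltW.
  - by rewrite /delta ge_min lexx.
have mu0 : 0 <= mu a by rewrite mulr_ge0 ?(ltW Mlow_gt0) ?powR_ge0.
have -> : (\int[Q]_z (xi_ (delta a) z ^+ 2)%:E
    = (Lnorm Q 2%:E (EFin \o xi_ (delta a))) `^ 2)%E.
  rewrite poweR_Lnorm//; apply: eq_integral => z _ /=.
  by rewrite powR_mulrn// real_normK ?num_real.
rewrite -powR_mulrn// -poweR_EFin; apply: gt0_ler_poweR => //.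
- by rewrite in_itv/= leey Lnorm_ge0.
- by rewrite in_itv/= leey lee_fin mu0.
by apply: le_trans xn _; rewrite lee_fin.
Qed.

Let xi_meas a : 0 < a -> measurable_fun setT (xi_ (delta a)).
Proof. by move=> a0; have [] := xi_envelope _ (delta_in a a0). Qed.

Let shell_ a := shell P theta_star theta_hat (a / 2 / rate) (delta a).

Let mu_gt0 a : 0 < a -> 0 < mu a.
Proof. by move=> a0; rewrite mulr_gt0 ?powR_gt0 ?divr_gt0. Qed.

Lemma prob_shell_le_inv a : 0 < a -> 4 <= signal a ->
  (P (shell_ a) <= (2 * eta_hat Mup / signal a)%:E)%E.
Proof.
move=> a0 s4; have dl := delta_in a a0; have [dl0 _] := andP dl.
have := prob_shell_le P Q Z Theta G theta_star M1 Z_indep Z_distr G_integrable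
  theta_star_in M1_gt0 risk_quadratic G_separable n n_gt0 theta_hat theta_hat_min
  false (a / 2 / rate) (delta a) (xi_ (delta a)) (mu a)
  (2 * eta_hat Mup / signal a) _ dl0 (xi_meas a a0) _.
rewrite /= (_ : mkset _ = setT) ?setIT; last by apply/seteqP; split.
apply; first by rewrite !divr_ge0// ltW.
move=> f M fF; rewrite thresholdE//.
have := prob_deviations_le_inv P Q Z Z_indep Z_distr _ (xi_ (delta a)) Mup (mu a)
  (local_class_measurable Q Theta G theta_star G_integrable theta_star_in (delta a))
  (xi_envelope _ dl) (entropy_bound _ dl) Mup_gt0 (mu_gt0 a a0) (xi_sqr a a0)
  f fF n.-1 M (signal a) s4.
by rewrite prednK.
Qed.

(** Since the second moment of the envelope is at most [mu a ^ 2], the event [event_B] implies the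
    truncation required by [deviation_event]; its complement is paid for separately. *)
Lemma prob_shell_le_exp a : 0 < a -> 4 <= signal a ->
  4 * eta_hat Mup <= signal a ->
  (P (shell_ a) <= (2 * expR (- (signal a ^+ 2 / 1000)))%:E
     + P (~` event_B P Z n (xi_ (delta a))))%E.
Proof.
move=> a0 s4 se; have dl := delta_in a a0; have [dl0 _] := andP dl.
set xi := xi_ (delta a); have mxi : measurable_fun setT xi := xi_meas a a0.
have mB : measurable (event_B P Z n xi).
  apply: measurable_le_set; apply: measurable_funM => //.
  apply: measurable_sum => j; apply: measurable_funX; exact: measurableT_comp.
pose S := [set w | true ==> (sum_sqr n xi (W w) <= 2 * n%:R * mu a ^+ 2)].
have mS : measurable (shell_ a `&` S).
  apply: measurableI; first exact: measurable_shell.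
  apply: measurable_le_set.
  exact: (measurableT_comp (measurable_sum_sqr n xi mxi) (measurable_sample _ _ _ _)).
have nR0 : (0 : R) < n%:R by rewrite ltr0n.
have BS : event_B P Z n xi `<=` S.
  move=> w; rewrite /event_B /S /= => Bw.
  have EB : fine ('E_P[fun w' => (xi (Z 0%N w') ^+ 2)%R])%E <= mu a ^+ 2.
    rewrite unlock (@ge0_integral_Z _ _ _ _ _ P Q Z Z_distr (fun z => (xi z ^+ 2)%:E)).
    + rewrite -lee_fin fineK; first exact: xi_sqr.
      rewrite ge0_fin_numE; first exact: le_lt_trans (xi_sqr a a0) (ltry _).
      by apply: integral_ge0 => z _; rewrite lee_fin sqr_ge0.
    + by apply/measurable_EFinP; exact: measurable_funX.
    + by move=> z; rewrite lee_fin sqr_ge0.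
  have -> : sum_sqr n xi (W w) = \sum_(j < n) xi (Z j w) ^+ 2.
    by apply: eq_bigr => j _; rewrite tnth_mktuple.
  move: Bw; rewrite mulrC ler_pdivrMr// => Bw; apply: le_trans Bw _.
  by have := ler_wpM2r (ltW nR0) EB; lra.
apply: le_trans (_ : P ((shell_ a `&` S) `|` ~` event_B P Z n xi) <= _)%E.
  apply: le_measure; rewrite ?inE.
  - exact: measurable_shell.
  - by apply: measurableU => //; exact: measurableC.
  - move=> w sw; have [Bw|nBw] := pselect (event_B P Z n xi w); last by right.
    by left; split => //; exact: BS.
apply: le_trans (measureU2 _ mS (measurableC mB)) _; apply: leeD => //.
apply: (prob_shell_le P Q Z Theta G theta_star M1 Z_indep Z_distr G_integrable
  theta_star_in M1_gt0 risk_quadratic G_separable n n_gt0 theta_hat theta_hat_min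
  true (a / 2 / rate) (delta a) xi (mu a)) => //.
  by rewrite !divr_ge0// ltW.
move=> f M fF; rewrite thresholdE//.
have := prob_deviations_le_exp P Q Z Z_indep Z_distr _ (xi_ (delta a)) Mup (mu a)
  (local_class_measurable Q Theta G theta_star G_integrable theta_star_in (delta a))
  (xi_envelope _ dl) (entropy_bound _ dl) Mup_gt0 (mu_gt0 a a0) (xi_sqr a a0)
  f fF n.-1 M (signal a) se s4.
by rewrite prednK.
Qed.

Lemma shell_eq0 a : diameter Theta < a / 2 / rate -> shell_ a = set0.
Proof.
move=> da; apply/seteqP; split => // w /= /andP[aw _].
have [Tw _] := theta_hat_min w; have := diam_ge _ Tw; lra.
Qed.

Lemma far_shells e0 : 0 < e0 ->
  [set w | e0 < rate * enorm (theta_hat w - theta_star)]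
  `<=` \bigcup_j shell_ (e0 * 2 ^+ j.+1).
Proof.
move=> e00 w /= ew; set x := enorm _ in ew *.
have r0 := rate_gt0.
have exj : exists j, rate * x <= e0 * 2 ^+ j.+1.
  have [j hj] : exists j : nat, rate * x / e0 <= j%:R.
    by exists (Num.bound (rate * x / e0)); apply: ltW; apply: archi_boundP;
      rewrite divr_ge0 ?mulr_ge0 ?(ltW r0) ?(ltW e00) ?sqrtr_ge0.
  exists j; rewrite [leRHS]mulrC -ler_pdivrMr//; apply: le_trans hj _.
  by rewrite -natrX ler_nat (leq_trans (ltnW (ltn_expl j (ltnSn 1))))// leq_exp2l.
case: (ex_minnP exj) => j hj jmin; exists j => //.
have [Tw _] := theta_hat_min w.
have low : e0 * 2 ^+ j < rate * x.
  case: j {hj} jmin => [|j] jmin; first by rewrite expr0 mulr1.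
  by rewrite ltNge; apply/negP => /jmin; rewrite ltnn.
apply/andP; split.
  rewrite -/x ltr_pdivrMr// [ltRHS]mulrC.
  by rewrite (_ : _ / 2 = e0 * 2 ^+ j)// exprS; field.
by rewrite -/x /delta le_min diam_ge// andbT ler_pdivlMr// mulrC.
Qed.

Lemma measurable_far e0 :
  measurable [set w | e0 < rate * enorm (theta_hat w - theta_star)].
Proof.
apply: measurable_gt_set; apply: measurable_funM => //.
exact: measurable_enorm_theta_hat.
Qed.

Lemma signal_gt0 a : 0 < a -> 0 < signal a.
Proof. by move=> a0; rewrite mulr_gt0 ?powR_gt0// divr_gt0 ?mulr_gt0. Qed.

(** The exponent [2 - beta] is at least 1. *)
Lemma signal_double a j : 0 < a -> signal a * 2 ^+ j <= signal (a * 2 ^+ j).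
Proof.
move=> a0; rewrite /signal powRM ?exprn_ge0 ?(ltW a0)// mulrA.
rewrite ler_wpM2l//; first by rewrite -/(signal a) ltW// signal_gt0.
rewrite -powR_mulrn// -powRrM ler_powR ?ler1n//.
by rewrite ler_peMr ?ler0n//; have := beta_le1; lra.
Qed.

Lemma prob_far_le e0 : 0 < e0 ->
  (P [set w | (e0 < rate * enorm (theta_hat w - theta_star))%R]
   <= (4 * eta_hat Mup / signal (2 * e0))%:E)%E.
Proof.
move=> e00; have s0 : 0 < signal (2 * e0) by rewrite signal_gt0// mulr_gt0.
have eta0 : 16 <= eta_hat Mup by have := eta_hat_ge _ Mup_gt0; lra.
(* For a signal below 4 the claimed bound exceeds 1, as [eta_hat Mup] is at least 16. *)
have [s4|s4] := leP 4 (signal (2 * e0)); last first.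
  apply: le_trans (probability_le1 P (measurable_far e0)) _.
  by rewrite lee_fin ler_pdivlMr// mul1r; lra.
apply: le_trans (measure_sigma_subadditive _ _ (measurable_far e0) (far_shells e0 e00)) _.
  by move=> j; exact: measurable_shell.
have -> : 4 * eta_hat Mup / signal (2 * e0) = 2 * (2 * eta_hat Mup / signal (2 * e0)).
  by field; rewrite gt_eqF.
apply: nneseries_le_geometric => // j.
have aj : 0 < e0 * 2 ^+ j.+1 by rewrite mulr_gt0 ?exprn_gt0.
have sj : signal (2 * e0) * 2 ^+ j <= signal (e0 * 2 ^+ j.+1).
  have -> : e0 * 2 ^+ j.+1 = 2 * e0 * 2 ^+ j by rewrite exprS; ring.
  by rewrite signal_double// mulr_gt0.
have s4j : 4 <= signal (e0 * 2 ^+ j.+1).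
  by apply: le_trans s4 _; apply: le_trans sj; rewrite ler_peMr ?(ltW s0)// exprn_ege1// ler1n.
apply: le_trans (prob_shell_le_inv _ aj s4j) _.
rewrite lee_fin -[X in _ <= X]mulrA -invfM ler_wpM2l//.
  by rewrite mulr_ge0//; lra.
by rewrite lef_pV2 ?posrE ?signal_gt0// mulr_gt0 ?exprn_gt0.
Qed.

(** A shell whose inner radius exceeds the diameter is empty, so only the indices in the condition
    of the sum contribute a complement of [event_B]. *)
Lemma prob_far_le_exp e0 : 0 < e0 ->
  4 * eta_hat Mup <= signal (2 * e0) -> 64 <= signal (2 * e0) ->
  (P [set w | (e0 < rate * enorm (theta_hat w - theta_star))%R]
   <= (4 * expR (- (signal (2 * e0) ^+ 2 / 1000)))%:E
      + \sum_(j <oo | (e0 * 2 ^+ j / rate <= diameter Theta)%R)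
          P (~` event_B P Z n (xi_ (Num.min (e0 * 2 ^+ j.+1 / rate) (diameter Theta))%R)))%E.
Proof.
move=> e00 se s64; set s := signal (2 * e0) in se s64 *.
have s0 : 0 < s by lra.
apply: le_trans (measure_sigma_subadditive _ _ (measurable_far e0) (far_shells e0 e00)) _.
  by move=> j; exact: measurable_shell.
pose u j : \bar R := (2 * expR (- (signal (e0 * 2 ^+ j.+1) ^+ 2 / 1000)))%:E.
pose v (j : nat) : \bar R := if e0 * 2 ^+ j / rate <= diameter Theta
  then P (~` event_B P Z n (xi_ (delta (e0 * 2 ^+ j.+1)))) else 0%E.
have u0 j : (0 <= u j)%E by rewrite lee_fin mulr_ge0 ?expR_ge0.
have v0 j : (0 <= v j)%E by rewrite /v; case: ifP.
have sj j : s * 2 ^+ j <= signal (e0 * 2 ^+ j.+1).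
  have -> : e0 * 2 ^+ j.+1 = 2 * e0 * 2 ^+ j by rewrite exprS; ring.
  by rewrite signal_double// mulr_gt0.
have ssj j : s <= signal (e0 * 2 ^+ j.+1).
  by apply: le_trans (sj j); rewrite ler_peMr ?(ltW s0)// exprn_ege1// ler1n.
apply: le_trans (_ : \sum_(j <oo) (u j + v j) <= _)%E.
  apply: lee_nneseries => // j _; have aj : 0 < e0 * 2 ^+ j.+1 by rewrite mulr_gt0 ?exprn_gt0.
  rewrite /u /v; case: ifPn => [_|].
    by apply: prob_shell_le_exp => //; apply: le_trans (ssj j); lra.
  rewrite -ltNge => far; rewrite -/(shell_ _) shell_eq0 ?measure0 ?adde0 ?u0//.
  by rewrite (_ : e0 * 2 ^+ j.+1 / 2 = e0 * 2 ^+ j)// exprS; field.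
rewrite nneseriesD//; apply: leeD; last by rewrite -eseries_mkcond.
have -> : 4 * expR (- (s ^+ 2 / 1000)) = 2 * (2 * expR (- (s ^+ 2 / 1000))) by ring.
apply: nneseries_le_geometric => // j; rewrite lee_fin -mulrA ler_pM2l//.
(* The squared signal of shell j is at least s^2 4^j >= s^2 (1 + 3j); with s >= 64 this adds at
   least j to the exponent, and exp(-j) <= 2^(-j). *)
apply: le_trans (_ : expR (- (s ^+ 2 / 1000) - j%:R) <= _).
  rewrite ler_expR -opprD lerN2.
  have j4 : 1 + 3 * j%:R <= (2 ^+ j) ^+ 2 :> R.
    elim: j => [|j IH]; first by rewrite mulr0 addr0 expr0 expr1n.
    rewrite [2 ^+ j.+1]exprS exprMn -natr1; have : (0 : R) <= j%:R by []. lra.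
  have ssq : s ^+ 2 * (2 ^+ j) ^+ 2 <= signal (e0 * 2 ^+ j.+1) ^+ 2.
    rewrite -exprMn; apply: lerXn2r; rewrite ?nnegrE ?sj//.
      by rewrite mulr_ge0 ?exprn_ge0 ?(ltW s0).
    exact: le_trans (ltW s0) (ssj j).
  have s2 : 64 * 64 <= s ^+ 2 by rewrite expr2 ler_pM.
  have s2j : 64 * 64 * j%:R <= s ^+ 2 * j%:R by rewrite ler_wpM2r.
  have j0 : (0 : R) <= j%:R by [].
  have := le_trans (ler_wpM2l (sqr_ge0 s) j4) ssq.
  move: (s ^+ 2) (signal _ ^+ 2) s2 s2j => S S' s2 s2j.
  lra.
rewrite expRD ler_wpM2l ?expR_ge0// expRN lef_pV2 ?posrE ?expR_gt0 ?exprn_gt0//.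
rewrite -[j%:R]mulr1 expRM_natl lerXn2r ?nnegrE ?expR_ge0//.
by have := expR_ge1Dx (1 : R); lra.
Qed.

End Tail.

(** * Comparison with the two announced bounds *)

Section Claims.
Context {R : realType}.
Variables (M1 beta Mlow : R).
Hypotheses (M1_gt0 : 0 < M1) (beta_gt0 : 0 < beta) (beta_le1 : beta <= 1) (Mlow_gt0 : 0 < Mlow).

(** The left side is 16 Mlow eta / M1 divided by (2 eps)^(2 - beta), while 2/eps = 4/(2 eps) and
    4^(2 - beta) >= 4 > 16/10. The factor [2 / eps] with exponent 1/2 is split off and enlarged by
    the minimum. *)
Lemma inv_signal_le eta eps : 0 < eta -> 0 < eps ->
  4 * eta / signal M1 beta Mlow (2 * eps)
  <= 10 * Mlow * eta / M1 * (2 / eps) `^ (3 / 2 - beta)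
     * Num.sqrt (2 / Num.min eps 2).
Proof.
move=> eta0 e0; have te0 : 0 < 2 / eps by rewrite divr_gt0.
have tt0 : 0 < 2 * eps by rewrite mulr_gt0.
have m0 : 0 < Num.min eps 2 by rewrite lt_min e0 ltr0n.
apply: le_trans (_ : 10 * Mlow * eta / M1 * (2 / eps) `^ (2 - beta) <= _); last first.
  rewrite -[leRHS]mulrA ler_wpM2l//; first by rewrite divr_ge0 ?mulr_ge0 ?ltW.
  rewrite (_ : 2 - beta = (3 / 2 - beta) + 2^-1); last by field.
  rewrite powR_add// ler_wpM2l ?powR_ge0// powR12_sqrt ?(ltW te0)// ler_wsqrtr//.
  by rewrite ler_pM2l// lef_pV2 ?posrE// ge_min lexx.
have -> : 2 / eps = 4 * (2 * eps)^-1 by field; rewrite gt_eqF.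
rewrite powRM ?invr_ge0 ?(ltW tt0)//.
have -> : (2 * eps)^-1 `^ (2 - beta) = ((2 * eps) `^ (2 - beta))^-1.
  by rewrite -[(2 * eps)^-1]powR_inv1 ?(ltW tt0)// -powRrM mulN1r powRN.
rewrite /signal; have p0 : 0 < (2 * eps) `^ (2 - beta) by rewrite powR_gt0.
have -> : 4 * eta / (M1 / (4 * Mlow) * (2 * eps) `^ (2 - beta))
    = 10 * Mlow * eta / M1 * (8 / 5 / (2 * eps) `^ (2 - beta)).
  by field; rewrite !gt_eqF.
rewrite ler_wpM2l//; first by rewrite divr_ge0 ?mulr_ge0 ?ltW.
rewrite ler_wpM2r ?invr_ge0 ?powR_ge0//.
apply: le_trans (_ : 4 `^ 1 <= _); first by rewrite powRr1//; lra.
by rewrite ler_powR ?ler1n//; have := beta_le1; lra.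
Qed.

Section Exponential.
Variables (Mup eps t : R).
Hypotheses (Mup_gt0 : 0 < Mup) (eps_gt0 : 0 < eps) (t_gt0 : 0 < t).
Hypothesis t_small :
  4 * Mlow * (1 + 2 * (t + 1) * eta_hat Mup) / M1
  < 2 `^ ((K_ eps)%:~R * (2 - beta) - Num.max (K_ eps)%:~R 0 / 2).

Let X := M1 / (4 * Mlow)
  * 2 `^ ((K_ eps)%:~R * (2 - beta) - Num.max (K_ eps)%:~R 0 / 2).
Let s := signal M1 beta Mlow (2 * 2 ^ K_ eps).

Let X_gt : 1 + 2 * (t + 1) * eta_hat Mup < X.
Proof.
have c0 : 0 < M1 / (4 * Mlow) by rewrite divr_gt0 ?mulr_gt0.
move: t_small; rewrite -(ltr_pM2l c0); apply: le_lt_trans.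
by rewrite le_eqVlt; apply/orP; left; apply/eqP; field; rewrite !gt_eqF.
Qed.

Let X_eta : 1 + 2 * eta_hat Mup <= X.
Proof.
have := eta_hat_ge _ Mup_gt0 => e62.
have : 0 <= t * eta_hat Mup by rewrite mulr_ge0 ?(ltW t_gt0)//; lra.
by have := X_gt; lra.
Qed.

(** The first shell ends at 2^(K+1); the extra exponent [2 - beta >= 1] supplies the factor 2, and
    subtracting half the positive part of K only lowers [X]. *)
Let signal_ge : 2 * X <= s.
Proof.
rewrite /s /X /signal mulrCA ler_wpM2l//; first by rewrite divr_ge0 ?mulr_ge0 ?ltW.
have -> : 2 * 2 ^ K_ eps = 2 `^ ((K_ eps)%:~R + 1) :> R.
  by rewrite powR_add// powRr1// powR_intmul// mulrC.
rewrite -powRrM -[leLHS]/(2 * _) -[X in X * _](@powRr1 R 2)// -powR_add// ler_powR ?ler1n//.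
have : 0 <= Num.max (K_ eps)%:~R 0 :> R by rewrite le_max lexx orbT.
by have := beta_le1; lra.
Qed.

Lemma signal_ge_eta : 4 * eta_hat Mup <= s.
Proof. by have := signal_ge; have := X_eta; lra. Qed.

Lemma signal_ge64 : 64 <= s.
Proof. by have := signal_ge_eta; have := eta_hat_ge _ Mup_gt0; lra. Qed.

(** With D = (3/2 - beta) ln 2, [P1] is exp(-y g_rate(t)) / (D y), and [y <= X] because eps <=
    2^(K+1). The threshold 126 is 1 + 2 * (125/2), from the assumption on [t] and the lower bound on
    [eta_hat]. *)
Lemma exp_signal_le : 4 * expR (- (s ^+ 2 / 1000)) <= P1 beta M1 Mlow t eps.
Proof.
have m0 : 0 < Num.min eps 2 by rewrite lt_min eps_gt0 ltr0n.
set u := eps `^ (3 / 2 - beta) * Num.sqrt (Num.min eps 2).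
have u0 : 0 < u by rewrite mulr_gt0 ?powR_gt0 ?sqrtr_gt0.
have ln20 : 0 < ln 2 :> R by rewrite ln_gt0// ltr1n.
have ln21 : ln 2 <= 1 :> R by apply: (@le_ln1Dx R 1); lra.
pose y := u * M1 / (2 `^ (4 - beta) * Mlow).
have p0 : 0 < 2 `^ (4 - beta) :> R by rewrite powR_gt0.
have y0 : 0 < y by rewrite /y divr_gt0 ?(mulr_gt0 u0) ?(mulr_gt0 p0).
have D0 : 0 < (3 / 2 - beta) * ln 2 by rewrite mulr_gt0//; have := beta_le1; lra.
have D2 : (3 / 2 - beta) * ln 2 <= 2.
  apply: le_trans (_ : 2 * 1 <= _); last by rewrite mulr1.
  by rewrite ler_pM ?(ltW ln20)//; have := beta_gt0; have := beta_le1; lra.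
have yX : y <= X.
  rewrite ler_pdivrMr ?mulr_gt0//.
  have [_ /(powR_min_le _ beta _ eps_gt0 beta_le1)] := K_itv _ eps_gt0.
  rewrite -/u => uE; apply: le_trans (ler_wpM2r (ltW M1_gt0) uE) _.
  have -> : 2 `^ (4 - beta) = 4 * 2 `^ (2 - beta) :> R.
    rewrite (_ : 4 - beta = 2 + (2 - beta)); last by ring.
    by rewrite powR_add// powR_mulrn//; ring.
  by rewrite le_eqVlt; apply/orP; left; apply/eqP; rewrite /X; field; rewrite gt_eqF.
have X126 : 126 <= X.
  by have := X_eta; have := eta_hat_ge _ Mup_gt0; have := Mup_gt0; lra.
apply: le_trans (exp_sqr_le_inv_exp _ _ _ _ _ X126 y0 yX signal_ge D0 D2
  (g_rate_ge0 _ t_gt0) (g_rate_le _ t_gt0)) _.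
rewrite le_eqVlt; apply/orP; left; apply/eqP.
have -> : y * g_rate t = eps `^ (3 / 2 - beta) * Num.sqrt (Num.min eps 2) * M1
    * g_rate t / (2 `^ (4 - beta) * Mlow) by rewrite /y /u mulrAC.
rewrite /P1 mulrC; congr (_ * _); rewrite /y /u; field.
by rewrite !gt_eqF ?sqrtr_gt0 ?powR_gt0//; have := beta_le1; lra.
Qed.
End Exponential.
End Claims.

(** * Reindexing the series of the events [event_B] *)

Section Series.
Context {R : realType} {m d : nat}.
Local Notation Rd := (borel_rV R d).
Context {dO} {Omega : measurableType dO} (P : probability Omega R)
  (Z : nat -> {RV P >-> Rd}).
Variables (Theta : set 'rV[R]_m) (xi_ : R -> Rd -> R) (beta eps : R) (n : nat).

Let rate : R := n%:R `^ (4 - 2 * beta)^-1.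

Let deltaE (j : nat) : delta_ beta n (K_ eps + j%:Z) = 2 ^ K_ eps * 2 ^+ j / rate.
Proof. by rewrite /delta_ expfzDr// powRN -exprnP. Qed.

(** The substitution k = K + j + 1 turns the condition on index k - 1 into one on the inner radius
    of shell j. *)
Lemma P3_series :
  (P3 Theta P Z xi_ beta eps n
   = \sum_(j <oo | (2 ^ K_ eps * 2 ^+ j / rate <= diameter Theta)%R)
       P (~` event_B P Z n
         (xi_ (Num.min (2 ^ K_ eps * 2 ^+ j.+1 / rate) (diameter Theta))%R)))%E.
Proof.
rewrite nneseries_esum//.
rewrite /P3 (@reindex_esum _ _ _ [set j : nat | 2 ^ K_ eps * 2 ^+ j / rate <= diameter Theta]
  (shells Theta beta eps n) (fun j => K_ eps + j.+1%:Z)).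
  by apply: eq_esum => j _; rewrite deltaE.
split.
- by move=> j /= jd; split; [rewrite lerD2l|rewrite intS addrCA addrAC subrr add0r deltaE].
- by move=> i j _ _ /addrI [].
- move=> k /= [Kk kd].
  have [j kE] : exists j : nat, k = K_ eps + j.+1%:Z.
    exists (absz (k - (K_ eps + 1))%R).
    by rewrite intS gez0_abs ?subr_ge0// addrA addrC subrK.
  exists j; last by rewrite kE.
  by move: kd; rewrite kE intS addrA addrAC addrK deltaE.
Qed.

End Series.

(** * The Euclidean norm: compact balls and the diameter *)

Section EuclideanNorm.
Context {R : realType} {m : nat}.
Implicit Types (x v : 'rV[R]_m) (A : set 'rV[R]_m).

Lemma continuous_enorm : continuous (@enorm R m).
Proof.
have h : continuous (fun v : 'rV[R]_m => \sum_(i < m) v 0 i ^+ 2).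
  apply: continuous_big => [|i _ x]; first exact: add_continuous.
  by apply: (@cvg_comp _ _ _ (fun v : 'rV[R]_m => v 0 i) (fun y => y ^+ 2));
    [exact: coord_continuous|exact: exprn_continuous].
by move=> x; apply: (@cvg_comp _ _ _ _ Num.sqrt _ _ _ (h x)); exact: sqrt_continuous.
Qed.

Lemma enormZ (c : R) v : 0 <= c -> enorm (c *: v) = c * enorm v.
Proof.
move=> c0; rewrite /enorm; under eq_bigr do rewrite mxE exprMn.
by rewrite -mulr_sumr sqrtrM ?sqr_ge0// sqrtr_sqr ger0_norm.
Qed.

Lemma compact_enorm_ball (r : R) : compact [set v : 'rV[R]_m | enorm v <= r].
Proof.
have coord (v : 'rV[R]_m) : enorm v <= r -> forall i, (`[- r, r]%classic : set R) (v ord0 i).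
  move=> vr i; rewrite /= in_itv/= -ler_norml; apply: le_trans vr.
  rewrite -sqrtr_sqr ler_wsqrtr// (bigD1 i)//= lerDl.
  by apply: sumr_ge0 => j _; exact: sqr_ge0.
apply: subclosed_compact coord; last first.
  by apply: (rV_compact (A := fun=> `[- r, r]%classic)) => i; exact: segment_compact.
apply: (@closed_comp _ _ (@enorm R m) [set y | y <= r]); last exact: closed_le.
by move=> x _; exact: continuous_enorm.
Qed.

(** A real [sup] is an upper bound only for bounded sets; here the distances form the continuous
    image of the compact [A] times [A]. *)
Lemma enorm_le_diameter A x y : compact A -> A x -> A y -> enorm (x - y) <= diameter A.
Proof.
move=> cA Ax Ay; apply: sup_upper_bound; last by exists x => //; exists y.
split; first by exists (enorm (x - y)), x => //; exists y.
have cB : compact ((fun p => enorm (p.1 - p.2)) @` (A `*` A)).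
  apply: continuous_compact; last exact: compact_setX.
  apply: continuous_subspaceT => p; apply: continuous_comp; last exact: continuous_enorm.
  by apply: cvgB; [exact: cvg_fst|exact: cvg_snd].
have [M [_ /(_ (M + 1)) Mb]] := compact_bounded cB.
exists (M + 1) => _ [u Au [v Av <-]]; apply: le_trans (ler_norm _) _.
by apply: Mb; [rewrite ltrDl|exists (u, v)].
Qed.

End EuclideanNorm.

(** For 2a >= 1 the power (2a)^(2 - beta) is at least 2a, so a choice of [a] linear in c / e
    suffices. *)
Lemma signal_large {R : realType} (M1 beta Mlow c e : R) :
  0 < M1 -> beta <= 1 -> 0 < Mlow -> 0 < c -> 0 < e ->
  exists2 a, 0 < a & c / signal M1 beta Mlow (2 * a) <= e.
Proof.
move=> M10 b1 Ml0 c0 e0; pose k := M1 / (4 * Mlow).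
have k0 : 0 < k by rewrite divr_gt0 ?mulr_gt0.
pose a := (1 + c / (k * e)) / 2.
have q0 : 0 < c / (k * e) by rewrite divr_gt0// mulr_gt0.
have aE : 2 * a = 1 + c / (k * e) by rewrite /a; field; rewrite !gt_eqF.
have a0 : 0 < 2 * a by rewrite aE addr_gt0.
exists a; first by move: a0; rewrite pmulr_rgt0.
rewrite ler_pdivrMr ?signal_gt0// /signal -/k.
apply: le_trans (_ : e * (k * (2 * a)) <= _).
  have -> : e * (k * (2 * a)) = k * e + c by rewrite aE; field; rewrite !gt_eqF.
  by rewrite lerDr ltW// mulr_gt0.
rewrite ler_wpM2l ?(ltW e0)// ler_wpM2l ?(ltW k0)//.
rewrite -[X in X <= _](powRr1 (ltW a0)) ler_powR//; last by lra.
by rewrite aE lerDl ltW.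
Qed.

Theorem theorem7p1 (R : realType) (m d : nat)
    (disp : measure_display) (Omega : measurableType disp)
    (P : probability Omega R) (PZ : probability (borel_rV R d) R)
    (Z : nat -> {RV P >-> borel_rV R d})
    (Theta : set 'rV[R]_m) (G : 'rV[R]_m -> borel_rV R d -> R)
    (theta_hat : nat -> {RV P >-> borel_rV R m})
    (theta_star : 'rV[R]_m)
    (xiG : borel_rV R d -> R) (xi_ : R -> borel_rV R d -> R)
    (M1 beta Mlow Mup : R)
    (m_gt0 : (0 < m)%N) (d_gt0 : (0 < d)%N)
    (P_complete : measure_is_complete P) (P_atomless : atomless P)
    (Z_indep : mutually_independent P Z)
    (Z_distr : common_distribution P Z PZ)
    (Theta_compact : compact Theta) (Theta_diam : 0 < diameter Theta)
    (theta_hat_min : forall n, (0 < n)%N ->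
       M_estimator G Theta Z n (theta_hat n))
    (G_integrable : forall theta, Theta theta ->
       PZ.-integrable setT (EFin \o G theta))
    (G_continuous : continuous_in_probability G Theta PZ)
    (xiG_envelope : positive_envelope (full_class G Theta) xiG)
    (xiG_square : square_integrable PZ xiG)
    (theta_star_min : unique_minimizer Theta (risk G P Z) theta_star)
    (M1_gt0 : 0 < M1)
    (risk_quadratic : forall theta, Theta theta ->
       risk G P Z theta - risk G P Z theta_star
         >= M1 * enorm (theta - theta_star) ^+ 2)
    (G_separable : separability G Theta theta_star P Z PZ)
    (beta_gt0 : 0 < beta) (beta_le1 : beta <= 1)
    (Mlow_gt0 : 0 < Mlow) (Mup_gt0 : 0 < Mup)
    (xi_envelope : forall delta, 0 < delta <= diameter Theta ->
       positive_envelope (local_class G Theta theta_star delta) (xi_ delta))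
    (xi_square : forall delta, 0 < delta <= diameter Theta ->
       square_integrable PZ (xi_ delta))
    (xi_norm : forall delta, 0 < delta <= diameter Theta ->
       (Lnorm PZ 2%:E (EFin \o xi_ delta) <= (Mlow * delta `^ beta)%:E)%E)
    (entropy_bound : forall delta, 0 < delta <= diameter Theta ->
       (maxe (entropy_integral (local_class G Theta theta_star delta)
                (xi_ delta) (1 / 8))
             (entropy_integral (full_class G Theta) xiG (1 / 8))
          <= Mup%:E)%E) :
  (forall (a b eps : R) (n : nat), 0 < a -> 0 < b -> 0 < eps ->
     a * 2 `^ (beta + 1 / 2) <= b * eps `^ (beta + 1 / 2) ->
     (0 < n)%N ->
     Num.max (Mlow ^+ 2 * diameter Theta `^ (2 * beta) / 2)
       ((Mlow ^+ 2 * diameter Theta `^ (2 * beta + 1))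
          `^ ((4 - 2 * beta) / (3 - 2 * beta))) <= n%:R ->
     let far := [set w | eps < n%:R `^ (4 - 2 * beta)^-1
                               * enorm (theta_hat n w - theta_star)] in
     (P far <= (10 * Mlow * eta_hat Mup / M1 * (2 / eps) `^ (3 / 2 - beta)
                  * Num.sqrt (2 / Num.min eps 2))%:E
               + P2 G Theta theta_star P Z beta b eps n
               + P (~` event_global G Theta P Z n a))%E /\
     (forall t : R, 0 < t ->
        2 `^ ((K_ eps)%:~R * (2 - beta) - Num.max (K_ eps)%:~R 0 / 2)
          > 4 * Mlow * (1 + 2 * (t + 1) * eta_hat Mup) / M1 ->
        (P far <= (P1 beta M1 Mlow t eps)%:E
                  + P2 G Theta theta_star P Z beta b eps n
                  + P3 Theta P Z xi_ beta eps n
                  + P (~` event_global G Theta P Z n a))%E)) /\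
  uniformly_tight P (fun n w =>
    n.+1%:R `^ (4 - 2 * beta)^-1 *: (theta_hat n.+1 w - theta_star)).
Proof.
have [theta_star_in _] := theta_star_min.
have diam_ge theta : Theta theta -> enorm (theta - theta_star) <= diameter Theta.
  by move=> Tt; exact: enorm_le_diameter.
have local_entropy delta : 0 < delta <= diameter Theta ->
    (entropy_integral (local_class G Theta theta_star delta) (xi_ delta) (1 / 8)
     <= Mup%:E)%E.
  by move=> /entropy_bound; rewrite ge_max => /andP[].
have far_le n (n0 : (0 < n)%N) e (e0 : 0 < e) :=
  prob_far_le P PZ Z Theta G theta_star M1 beta Mlow Mup xi_ Z_indep Z_distr
    G_integrable theta_star_in M1_gt0 risk_quadratic G_separable Theta_diam
    diam_ge beta_gt0 beta_le1 Mlow_gt0 Mup_gt0 xi_envelope xi_norm local_entropy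
    n (theta_hat n) n0 (theta_hat_min n n0) e e0.
have far_le_exp n (n0 : (0 < n)%N) :=
  prob_far_le_exp P PZ Z Theta G theta_star M1 beta Mlow Mup xi_ Z_indep Z_distr
    G_integrable theta_star_in M1_gt0 risk_quadratic G_separable Theta_diam
    diam_ge beta_gt0 beta_le1 Mlow_gt0 Mup_gt0 xi_envelope xi_norm local_entropy
    n (theta_hat n) n0 (theta_hat_min n n0).
have m_far n e := measurable_far P theta_star beta n (theta_hat n) e.
have eta0 : 0 < eta_hat Mup by have := eta_hat_ge _ Mup_gt0; lra.
split.
- move=> a b eps n a0 b0 eps0 _ n0 _ far.
  have P20 : (0 <= P2 G Theta theta_star P Z beta b eps n)%E.
    by apply: esum_ge0 => k _; exact: measure_ge0.
  have Pa0 : (0 <= P (~` event_global G Theta P Z n a))%E by exact: measure_ge0.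
  split.
    rewrite -addeA; apply: le_trans (leeDl _ (adde_ge0 P20 Pa0)).
    by apply: le_trans (far_le n n0 _ eps0) _; rewrite lee_fin inv_signal_le.
  move=> t t0 small; have K0 : 0 < 2 ^ K_ eps :> R by rewrite exprz_gt0.
  have [KE _] := K_itv _ eps0.
  apply: le_trans (_ : (P1 beta M1 Mlow t eps)%:E + P3 Theta P Z xi_ beta eps n <= _)%E.
    (* Lowering the threshold from [eps] to [2 ^ K_ eps] enlarges the event and aligns the dyadic
       shells with those of [P3]. *)
    apply: le_trans (_ : P [set w | (2 ^ K_ eps < n%:R `^ (4 - 2 * beta)^-1
                               * enorm (theta_hat n w - theta_star))%R] <= _)%E.
      apply: le_measure; rewrite ?inE; [exact: m_far|exact: m_far|].
      by move=> w; apply: le_lt_trans; rewrite -powR_intmul.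
    have := far_le_exp n n0 _ K0
      (signal_ge_eta _ _ _ M1_gt0 beta_le1 Mlow_gt0 _ _ _ Mup_gt0 t0 small)
      (signal_ge64 _ _ _ M1_gt0 beta_le1 Mlow_gt0 _ _ _ Mup_gt0 t0 small).
    rewrite -P3_series => /le_trans; apply; apply: leeD => //.
    by rewrite lee_fin; exact: exp_signal_le small.
  rewrite -[X in (_ <= X)%E]addeA -[X in (_ <= X)%E]addeA leeD2l//.
  by rewrite addeCA leeDl// adde_ge0.
(* The first tail bound does not depend on n, so one radius, and thus one compact ball, serves the
   whole sequence. *)
move=> e e0.
have [r r0 re] := signal_large M1 beta Mlow (4 * eta_hat Mup) e M1_gt0 beta_le1
  Mlow_gt0 (mulr_gt0 (ltr0n _ 4) eta0) e0.
exists [set v | enorm v <= r]; split; first exact: compact_enorm_ball.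
move=> n; apply: le_trans (_ : (4 * eta_hat Mup / signal M1 beta Mlow (2 * r))%:E <= _)%E.
  apply: le_trans (far_le n.+1 (ltn0Sn n) r r0).
  rewrite (_ : ~` _ = [set w | r < n.+1%:R `^ (4 - 2 * beta)^-1
                               * enorm (theta_hat n.+1 w - theta_star)])//.
  by apply/seteqP; split => w /=; rewrite enormZ ?powR_ge0// ltNge => /negP.
by rewrite lee_fin.
Qed.
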